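(* Let $k$ be an algebraically closed field of characteristic zero, let $H$ be a semisimple Hopf algebra over $k$ and let $K \subseteq H$ be a Hopf subalgebra. Then $H \mid K$ is a symmetric Markov extension. In particular, the centralizer $R = C_H(K) = \{ r \in H : rx = xr \text{ for all } x \in K \}$ is a separable $k$-algebra.
   Context: A trace $t$ on a $k$-algebra $A$ is a linear map $t : A \to k$ with $t(ab) = t(ba)$ for all $a,b \in A$; it is normalized if $t(1_A) = 1$, and nondegenerate if $t(ab) = 0$ for all $b \in A$ implies $a = 0$. A $k$-algebra is strongly separable (in the sense of Kanzaki) if it has a separability idempotent that is symmetric, i.e. invariant under the flip $x \otimes y \mapsto y \otimes x$. A Frobenius extension $A \mid B$ of algebras is one possessing a Frobenius system: a $B$-$B$-bimodule map $E : A \to B$ (a Frobenius homomorphism) and finite families $\{x_i\}, \{y_i\}$ in $A$ (dual bases) with $\sum_i x_i E(y_i a) = a = \sum_i E(a x_i) y_i$ for all $a \in A$. It is free if $A_B$ is a free module (of finite rank). A symmetric Markov extension is a free Frobenius extension $A \mid B$ of $k$-algebras for which there is a Frobenius system $E : A \to B$, $\{x_i\}$, $\{y_i\}$ such that: (1) $E(1) = 1$; (2) $\sum_i x_i y_i = (\operatorname{rank} A_B)\, 1_A = \sum_i y_i x_i$; (3) the centralizer $R = A^B = \{ r \in A : rb = br \text{ for all } b \in B\}$ is a strongly separable algebra; (4) $Eu = uE$ for each $u \in R$, i.e. $E(ua) = E(au)$ for all $u \in R$, $a \in A$; (5) there is a normalized nondegenerate trace $t_B$ on $B$ such that $t_A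 = t_B \circ E$ is a nondegenerate (normalized) trace on $A$, and $t_A$ restricts to a nondegenerate trace on $R$. *)

(* Defs.v *)
From HB Require Import structures.
From mathcomp Require Import all_boot all_order all_algebra.
From mathcomp Require Import boolp.

Set Implicit Arguments.
Unset Strict Implicit.
Unset Printing Implicit Defensive.

Import GRing.Theory.
Local Open Scope ring_scope.

(* An element of V (x) V is given by a finite sequence of pairs
   s = [:: (u_1, v_1); ...; (u_n, v_n)], standing for \sum_i u_i (x) v_i;
   likewise sequences of triples stand for elements of V (x) V (x) V.
   Two sequences represent the same tensor iff no bilinear (trilinear) map
   into any k-vector space separates them, by the universal property of the
   tensor product. *)

Definition bilinear_map (k : fieldType) (V W : lmodType k) (f : V -> V -> W) :=
  (forall v, linear (fun u => f u v)) /\ (forall u, linear (f u)).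

Definition trilinear_map (k : fieldType) (V W : lmodType k)
    (f : V -> V -> V -> W) :=
  [/\ forall v w, linear (fun u => f u v w),
      forall u w, linear (fun v => f u v w)
    & forall u v, linear (f u v)].

Definition tens_eq (k : fieldType) (V : lmodType k) (s t : seq (V * V)) :=
  forall (W : lmodType k) (f : V -> V -> W), bilinear_map f ->
    \sum_(p <- s) f p.1 p.2 = \sum_(p <- t) f p.1 p.2.

Definition tens3_eq (k : fieldType) (V : lmodType k)
    (s t : seq (V * V * V)) :=
  forall (W : lmodType k) (f : V -> V -> V -> W), trilinear_map f ->
    \sum_(p <- s) f p.1.1 p.1.2 p.2 = \sum_(p <- t) f p.1.1 p.1.2 p.2.

(* comul x is a representative of x_(1) (x) x_(2); all axioms are stated up to
   equality of tensors, so the choice of representative is irrelevant. *)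
HB.mixin Record Algebra_isHopf (k : fieldType) H of GRing.Algebra k H := {
  comul : H -> seq (H * H);
  counit : H -> k;
  antipode : H -> H;
  comul_linear : forall (c : k) (x y : H),
    tens_eq (comul (c *: x + y))
            ([seq (c *: p.1, p.2) | p <- comul x] ++ comul y);
  comul1 : tens_eq (comul 1) [:: (1, 1)];
  comulM : forall x y : H,
    tens_eq (comul (x * y))
            [seq (p.1 * q.1, p.2 * q.2) | p <- comul x, q <- comul y];
  comulA : forall x : H,
    tens3_eq [seq (q.1, q.2, p.2) | p <- comul x, q <- comul p.1]
             [seq (p.1, q.1, q.2) | p <- comul x, q <- comul p.2];
  counit_linear : scalar counit;
  counit1 : counit 1 = 1;
  counitM : {morph counit : x y / x * y};
  comul_counitl : forall x : H, \sum_(p <- comul x) counit p.1 *: p.2 = x;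
  comul_counitr : forall x : H, \sum_(p <- comul x) counit p.2 *: p.1 = x;
  antipode_linear : linear antipode;
  antipodel : forall x : H,
    \sum_(p <- comul x) antipode p.1 * p.2 = (counit x)%:A;
  antipoder : forall x : H,
    \sum_(p <- comul x) p.1 * antipode p.2 = (counit x)%:A
}.

#[short(type="hopfAlgType")]
HB.structure Definition HopfAlgebra (k : fieldType) :=
  {H of GRing.Algebra k H & Algebra_isHopf k H}.

(* The tensor represented by s lies in (the image of) B (x) B. *)
Definition tens_in (k : fieldType) (V : lmodType k) (B : {pred V})
    (s : seq (V * V)) :=
  exists2 t, tens_eq s t & {in t, forall p, p.1 \in B /\ p.2 \in B}.

Definition hopf_subalgebra (k : fieldType) (H : hopfAlgType k)
    (K : {pred H}) :=
  [/\ subalg_closed K,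
      {in K, forall x, tens_in K (comul x)}
    & {in K, forall x, antipode x \in K}].

Section Algebras.

Variables (k : fieldType) (A : algType k).
Implicit Types B R : {pred A}.

Definition left_ideal (I : {pred A}) :=
  zmod_closed I /\ forall a, {in I, forall x, a * x \in I}.

(* A is semisimple as a left module over itself: each left ideal is a direct
   summand. *)
Definition semisimple_algebra :=
  forall I, left_ideal I -> exists J, [/\ left_ideal J,
    forall x, x \in I -> x \in J -> x = 0
  & forall x, exists y z, [/\ y \in I, z \in J & x = y + z]].

Definition centralizer B : {pred A} :=
  [pred r | `[< {in B, forall b, r * b = b * r} >]].

(* e represents a separability idempotent of the subalgebra R. As k is a field,
   R (x) R embeds in A (x) A, so that tensors over R can be compared in
   A (x) A. *)
Definition separability_idempotent R (e : seq (A * A)) :=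
  [/\ {in e, forall p, p.1 \in R /\ p.2 \in R},
      \sum_(p <- e) p.1 * p.2 = 1
    & {in R, forall r, tens_eq [seq (r * p.1, p.2) | p <- e]
                               [seq (p.1, p.2 * r) | p <- e]}].

Definition separable_algebra R :=
  subalg_closed R /\ exists e, separability_idempotent R e.

Definition strongly_separable_algebra R :=
  subalg_closed R /\ exists2 e, separability_idempotent R e
    & tens_eq [seq (p.2, p.1) | p <- e] e.

(* For t : A -> k only the values of t on the subalgebra B are relevant in the
   next three definitions. *)
Definition trace_on B (t : A -> k) :=
  (forall c, {in B &, forall x y, t (c *: x + y) = c * t x + t y}) /\
  {in B &, forall x y, t (x * y) = t (y * x)}.

Definition normalized_trace_on B (t : A -> k) := trace_on B t /\ t 1 = 1.

Definition nondegenerate_trace_on B (t : A -> k) :=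
  trace_on B t /\
  {in B, forall a, {in B, forall b, t (a * b) = 0} -> a = 0}.

Definition bimodule_map B (E : {linear A -> A}) :=
  (forall a, E a \in B) /\
  (forall a, {in B &, forall b b', E (b * a * b') = b * E a * b'}).

Definition frobenius_system B (E : {linear A -> A}) (m : nat)
    (x y : 'I_m -> A) :=
  bimodule_map B E /\
  forall a, \sum_(i < m) x i * E (y i * a) = a /\
            \sum_(i < m) E (a * x i) * y i = a.

Definition right_basis B (n : nat) (e : 'I_n -> A) :=
  forall a, exists! b : {ffun 'I_n -> A},
    (forall i, b i \in B) /\ a = \sum_(i < n) e i * b i.

(* A_B is a free module of rank n. *)
Definition free_right_of_rank B (n : nat) := exists e, right_basis B (n := n) e.

Definition symmetric_markov_extension B :=
  let R := centralizer B in
  subalg_closed B /\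
  exists n, free_right_of_rank B n /\
  exists (E : {linear A -> A}) (m : nat) (x y : 'I_m -> A),
  [/\ frobenius_system B E x y,
      E 1 = 1,
      \sum_(i < m) x i * y i = n%:R /\ \sum_(i < m) y i * x i = n%:R,
      strongly_separable_algebra R
    & (forall u a, u \in R -> E (u * a) = E (a * u)) /\
      exists tB : A -> k,
        let tA := tB \o E in
        [/\ normalized_trace_on B tB, nondegenerate_trace_on B tB,
            normalized_trace_on predT tA, nondegenerate_trace_on predT tA
          & nondegenerate_trace_on R tA]].

End Algebras.

(* Main.v *)
(* A semisimple H has an integral L with eps L = 1.  Then L1 (x) S(L2) is a separability
   idempotent, so H is finite-dimensional and S is bijective, and lam(h) = tr(x |-> S^2(x h))
   is an integral of the dual with lam L = 1; its Nakayama automorphism is S^2 and, comparing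
   lam with lam o S, S^4 is conjugation by a grouplike g, which has finite order.
   Since the regular trace is nondegenerate, S^2 is conjugation by some w with w^M central, so
   tr(S^2) is a sum over the blocks of H of terms |tr(v)|^2 / dim with v^M = 1, which is nonzero
   because it is positive when evaluated at roots of unity in algC.  As tr(S^2) = lam 1, this
   gives g = 1 and S^4 = 1; the projection Q h = chi(h1) h2 / n, for chi the regular character
   and n = dim H, satisfies n tr(S^2 Q) = tr(S^2), and comparing integers yields S^2 = 1
   (Larson-Radford).
   Now t = lam / n is a normalized trace with t(h1) h2 = t(h) 1, nondegenerate on every Hopf
   subalgebra K, with dual bases satisfying \sum e_i q_i = \sum q_i e_i = dim K.  Everything
   follows: E is the t-orthogonal projection onto K, dual bases of H over K are those of H for t
   divided by dim K, the character of H as a K-module is a multiple of the regular one, hence H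
   is free over K, and t is nondegenerate on the centralizer R, whose Casimir element is
   invertible. *)

Require Import Defs.
From HB Require Import structures.
From mathcomp Require Import all_boot all_order all_algebra.
From mathcomp Require Import cyclic separable algC cyclotomic.
From mathcomp Require Import boolp classical_sets zify.

Set Implicit Arguments.
Unset Strict Implicit.
Unset Printing Implicit Defensive.

Import GRing.Theory.
Local Open Scope ring_scope.

(** * Linearity and Sweedler sums *)

Section Linear.
Variable k : fieldType.

Definition lin (V W : lmodType k) (f : V -> W) :=
  forall c u v, f (c *: u + v) = c *: f u + f v.

Definition slin (V : lmodType k) (t : V -> k) :=
  forall c u v, t (c *: u + v) = c * t u + t v.

Definition bil (V W : lmodType k) (f : V -> V -> W) :=
  (forall v, lin (fun u => f u v)) /\ (forall u, lin (f u)).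

Implicit Types V W X : lmodType k.

Lemma slin_lin V (t : V -> k) : slin t -> lin (t : V -> k^o).
Proof. by []. Qed.

Lemma lin0 V W (f : V -> W) : lin f -> f 0 = 0.
Proof. by move=> h; have := h (-1) 0 0; rewrite scaler0 addr0 scaleN1r addNr. Qed.
Lemma linD V W (f : V -> W) : lin f -> {morph f : x y / x + y}.
Proof. by move=> h x y; have := h 1 x y; rewrite !scale1r. Qed.
Lemma linZ V W (f : V -> W) : lin f -> forall c x, f (c *: x) = c *: f x.
Proof. by move=> h c x; have := h c x 0; rewrite (lin0 h) !addr0. Qed.
Lemma linB V W (f : V -> W) : lin f -> {morph f : x y / x - y}.
Proof. by move=> h x y; rewrite -[- y]scaleN1r (linD h) (linZ h) scaleN1r. Qed.
Lemma lin_sumE V W (f : V -> W) : lin f -> forall I (r : seq I) P (F : I -> V),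
  f (\sum_(i <- r | P i) F i) = \sum_(i <- r | P i) f (F i).
Proof. by move=> h I r P F; rewrite (big_morph f (linD h) (lin0 h)). Qed.

Lemma slin0 V (t : V -> k) : slin t -> t 0 = 0.
Proof. by move/slin_lin/lin0. Qed.
Lemma slinD V (t : V -> k) : slin t -> {morph t : x y / x + y}.
Proof. by move/slin_lin/linD. Qed.
Lemma slinB V (t : V -> k) : slin t -> {morph t : x y / x - y}.
Proof. by move/slin_lin/linB. Qed.
Lemma slinZ V (t : V -> k) : slin t -> forall c x, t (c *: x) = c * t x.
Proof. by move/slin_lin/linZ. Qed.
Lemma slin_sumE V (t : V -> k) : slin t -> forall I (r : seq I) P (F : I -> V),
  t (\sum_(i <- r | P i) F i) = \sum_(i <- r | P i) t (F i).
Proof. by move=> h I r P F; rewrite (big_morph t (slinD h) (slin0 h)). Qed.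

Lemma lin_id V : lin (fun x : V => x). Proof. by []. Qed.
Lemma lin_zero V W : lin (fun _ : V => 0 : W).
Proof. by move=> c u v; rewrite scaler0 addr0. Qed.
Lemma lin_comp V W X (f : W -> X) (g : V -> W) : lin f -> lin g -> lin (fun x => f (g x)).
Proof. by move=> hf hg c u v; rewrite hg hf. Qed.
Lemma slin_comp V W (f : W -> k) (g : V -> W) : slin f -> lin g -> slin (fun x => f (g x)).
Proof. by move=> hf hg c u v; rewrite hg hf. Qed.
Lemma lin_add V W (f g : V -> W) : lin f -> lin g -> lin (fun x => f x + g x).
Proof. by move=> hf hg c u v; rewrite hg hf scalerDr addrACA. Qed.
Lemma lin_opp V W (f : V -> W) : lin f -> lin (fun x => - f x).
Proof. by move=> hf c u v; rewrite hf opprD scalerN. Qed.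
Lemma lin_scal V W (f : V -> W) c : lin f -> lin (fun x => c *: f x).
Proof. by move=> hf d u v; rewrite hf scalerDr !scalerA mulrC. Qed.
Lemma lin_scall V W (t : V -> k) (w : W) : slin t -> lin (fun x => t x *: w).
Proof. by move=> hf d u v; rewrite hf scalerDl scalerA. Qed.
Lemma lin_sum V W I (r : seq I) (P : pred I) (f : I -> V -> W) :
  (forall i, lin (f i)) -> lin (fun x => \sum_(i <- r | P i) f i x).
Proof.
move=> hf c u v; rewrite scaler_sumr -big_split /=.
by apply: eq_bigr => i _; rewrite hf.
Qed.
Lemma lin_mull V (A : algType k) (f : V -> A) a : lin f -> lin (fun x => a * f x).
Proof. by move=> hf c u v; rewrite hf mulrDr scalerAr. Qed.
Lemma lin_mulr V (A : algType k) (f : V -> A) a : lin f -> lin (fun x => f x * a).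
Proof. by move=> hf c u v; rewrite hf mulrDl scalerAl. Qed.
Lemma slin_add V (f g : V -> k) : slin f -> slin g -> slin (fun x => f x + g x).
Proof. exact: (@lin_add V k^o). Qed.
Lemma slin_opp V (f : V -> k) : slin f -> slin (fun x => - f x).
Proof. exact: (@lin_opp V k^o). Qed.
Lemma slin_mull V (f : V -> k) c : slin f -> slin (fun x => c * f x).
Proof. exact: (@lin_scal V k^o). Qed.
Lemma slin_mulr V (f : V -> k) c : slin f -> slin (fun x => f x * c).
Proof. by move=> hf d u v; rewrite hf mulrDl mulrA. Qed.
Lemma slin_zero V : slin (fun _ : V => 0).
Proof. by move=> c u v; rewrite mulr0 addr0. Qed.
Lemma slin_sum V I (r : seq I) (P : pred I) (f : I -> V -> k) :
  (forall i, slin (f i)) -> slin (fun x => \sum_(i <- r | P i) f i x).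
Proof. exact: (@lin_sum V k^o). Qed.

End Linear.

Section Sweedler.
Variables (k : fieldType) (H : hopfAlgType k).
Implicit Types (V W : lmodType k) (x y : H).
Local Notation S := (@antipode k H).
Local Notation eps := (@counit k H).

Definition sw W (f : H -> H -> W) x : W := \sum_(p <- comul x) f p.1 p.2.

Lemma bil_bilinear W (f : H -> H -> W) : bil f -> bilinear_map f.
Proof. by case=> h1 h2; split=> [v c a b|u c a b]; rewrite ?h1 ?h2. Qed.

Lemma eq_sw W (f g : H -> H -> W) x : (forall a b, f a b = g a b) -> sw f x = sw g x.
Proof. by move=> e; apply: eq_bigr. Qed.

Lemma lin_swx W (f : H -> H -> W) : bil f -> lin (sw f).
Proof.
move=> hf c x y; rewrite /sw (comul_linear c x y _ _ (bil_bilinear hf)) big_cat /= big_map /=.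
rewrite scaler_sumr; congr (_ + _); apply: eq_bigr => p _.
by rewrite (linZ (f := fun u => f u p.2)) //; apply: hf.1.
Qed.

Lemma lin_swf V W (F : V -> H -> H -> W) x :
  (forall a b, lin (fun v : V => F v a b)) -> lin (fun v => sw (F v) x).
Proof. by move=> h; apply: lin_sum. Qed.

Lemma sw_out V W (g : V -> W) (f : H -> H -> V) x : lin g ->
  g (sw f x) = sw (fun a b => g (f a b)) x.
Proof. by move=> hg; rewrite /sw lin_sumE. Qed.

Lemma sw1 W (f : H -> H -> W) : bil f -> sw f 1 = f 1 1.
Proof. by move=> hf; rewrite /sw (@comul1 k H W f (bil_bilinear hf)) big_seq1. Qed.

Lemma swM W (f : H -> H -> W) x y : bil f ->
  sw f (x * y) = sw (fun a b => sw (fun c d => f (a * c) (b * d)) y) x.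
Proof.
move=> hf; rewrite /sw (@comulM k H x y W f (bil_bilinear hf)) big_allpairs_dep /=.
by [].
Qed.

Lemma swA W (f : H -> H -> H -> W) x :
  (forall b c, lin (fun a => f a b c)) -> (forall a c, lin (fun b => f a b c)) ->
  (forall a b, lin (f a b)) ->
  sw (fun a b => sw (fun c d => f c d b) a) x = sw (fun a b => sw (fun c d => f a c d) b) x.
Proof.
move=> h1 h2 h3; have := @comulA k H x W f.
rewrite !big_allpairs_dep /=; apply.
by split=> u v c a b; rewrite ?h1 ?h2 ?h3.
Qed.

Lemma counit_lin : slin eps. Proof. by move=> c u v; exact: (@counit_linear k H c u v). Qed.
Lemma antipode_lin : lin S. Proof. by move=> c u v; exact: (@antipode_linear k H c u v). Qed.

Lemma sw_counitl W (f : H -> W) x : lin f -> sw (fun a b => eps a *: f b) x = f x.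
Proof.
move=> hf; rewrite -{2}(comul_counitl x) lin_sumE //; apply: eq_bigr => p _.
by rewrite linZ.
Qed.
Lemma sw_counitr W (f : H -> W) x : lin f -> sw (fun a b => eps b *: f a) x = f x.
Proof.
move=> hf; rewrite -{2}(comul_counitr x) lin_sumE //; apply: eq_bigr => p _.
by rewrite linZ.
Qed.
Lemma sw_antl W (f : H -> W) x : lin f -> sw (fun a b => f (S a * b)) x = eps x *: f 1.
Proof. by move=> hf; rewrite -linZ // -antipodel lin_sumE. Qed.
Lemma sw_antr W (f : H -> W) x : lin f -> sw (fun a b => f (a * S b)) x = eps x *: f 1.
Proof. by move=> hf; rewrite -linZ // -antipoder lin_sumE. Qed.

Lemma sw_swap W (F : H -> H -> H -> H -> W) x y :
  sw (fun a b => sw (fun c d => F a b c d) y) x = sw (fun c d => sw (fun a b => F a b c d) x) y.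
Proof. by rewrite /sw exchange_big. Qed.

Lemma swZ W (f : H -> H -> W) c x : sw (fun a b => c *: f a b) x = c *: sw f x.
Proof. by rewrite /sw scaler_sumr. Qed.

Lemma eq_sw_in (K : {pred H}) W (f g : H -> H -> W) x : bil f -> bil g ->
  tens_in K (comul x) -> {in K &, forall a b, f a b = g a b} -> sw f x = sw g x.
Proof.
move=> hf hg [t et tK] fg; rewrite /sw (et _ _ (bil_bilinear hf)) (et _ _ (bil_bilinear hg)).
by rewrite !big_seq; apply: eq_bigr => p /tK [? ?]; apply: fg.
Qed.

End Sweedler.

(* A pattern variable ?a may capture the bound variable, so whether an operand is constant
   is tested by matching the corresponding abstraction against (fun _ => ?a). *)
Ltac linp :=
  lazymatch goal with
  | |- forall _, _ => intro; linp
  | |- bil _ => split; linp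
  | |- _ /\ _ => split; linp
  | |- lin _ => first [eassumption | exact: antipode_lin | linp_lin]
  | |- slin _ => first [eassumption | exact: counit_lin | linp_slin]
  | |- _ => idtac
  end
with linp_lin :=
  lazymatch goal with
  | |- lin (fun x_ => x_) => exact: lin_id
  | |- lin (fun x_ => 0) => exact: lin_zero
  | |- lin (fun x_ => (@?f x_) + (@?g x_)) => apply: (@lin_add _ _ _ f g); linp
  | |- lin (fun x_ => - (@?f x_)) => apply: (@lin_opp _ _ _ f); linp
  | |- lin (fun x_ => (@?t x_) *: (@?f x_)) =>
      lazymatch t with
      | (fun _ => ?c) => apply: (@lin_scal _ _ _ f c)
      | _ => lazymatch f with (fun _ => ?w) => apply: (@lin_scall _ _ _ t w) end
      end; linp
  | |- lin (fun x_ => (@?f x_) * (@?g x_)) =>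
      lazymatch f with
      | (fun _ => ?a) => apply: (@lin_mull _ _ _ g a)
      | _ => lazymatch g with (fun _ => ?a) => apply: (@lin_mulr _ _ _ f a) end
      end; linp
  | |- lin (fun x_ => sw (@?F x_) (@?g x_)) =>
      lazymatch F with
      | (fun _ => ?f) => apply: (@lin_comp _ _ _ _ (sw f) g); [apply: (@lin_swx _ _ _ f); linp | linp]
      | _ => lazymatch g with (fun _ => ?y) => apply: (@lin_swf _ _ _ _ F y); cbv beta; linp end
      end
  | |- lin (fun x_ => \sum_(i <- _ | _) _) =>
      apply: lin_sum; cbv beta; linp
  | |- lin (sw ?f) => apply: (@lin_swx _ _ _ f); linp
  | |- lin _ => first [linp_app | linp_hyp]
  end
with linp_app :=
  match goal with
  | |- lin (fun x_ => ?h (@?g x_)) => apply: (@lin_comp _ _ _ _ h g);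
      [first [eassumption | exact: antipode_lin | linp_hyp] | linp]
  | |- lin (fun x_ => ?h (@?g x_) ?b) =>
      apply: (@lin_comp _ _ _ _ (fun y => h y b) g); [linp_hyp | linp]
  | |- lin (fun x_ => ?h (@?g x_) ?b1 ?b) =>
      apply: (@lin_comp _ _ _ _ (fun y => h y b1 b) g); [linp_hyp | linp]
  end
with linp_hyp :=
  cbv beta;
  match goal with
    | H0 : bil _ |- _ => first [exact: H0.1 | exact: H0.2]
    | H0 : _ |- _ => exact: H0
  end
with linp_slin :=
  lazymatch goal with
  | |- slin (fun x_ => 0) => exact: slin_zero
  | |- slin (fun x_ => (@?f x_) + (@?g x_)) => apply: (@slin_add _ _ f g); linp
  | |- slin (fun x_ => - (@?f x_)) => apply: (@slin_opp _ _ f); linp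
  | |- slin (fun x_ => (@?f x_) * (@?g x_)) =>
      lazymatch f with
      | (fun _ => ?a) => apply: (@slin_mull _ _ g a)
      | _ => lazymatch g with (fun _ => ?a) => apply: (@slin_mulr _ _ f a) end
      end; linp
  | |- slin (fun x_ => \sum_(i <- _ | _) _) =>
      apply: slin_sum; cbv beta; linp
  | |- slin (fun x_ => ?h (@?g x_)) =>
      apply: (@slin_comp _ _ _ h g); [first [eassumption | exact: counit_lin | linp_hyp] | linp]
  | |- slin _ => linp_hyp
  end.

Section Antipode.
Variables (k : fieldType) (H : hopfAlgType k).
Implicit Types (V W : lmodType k) (x y : H).
Local Notation S := (@antipode k H).
Local Notation eps := (@counit k H).

Lemma antipode1 : S 1 = 1.
Proof.
have := @sw_antl k H H (fun z => z) 1 (@lin_id _ _); rewrite sw1 ?counit1 ?scale1r ?mulr1 //.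
linp.
Qed.

Lemma antipodeM x y : S (x * y) = S y * S x.
Proof.
have U b d : sw (fun b1 b2 => sw (fun d1 d2 => b1 * d1 * (S d2 * S b2)) d) b
    = (eps b * eps d) *: 1.
  under eq_sw => b1 b2.
    have -> : sw (fun d1 d2 => b1 * d1 * (S d2 * S b2)) d = eps d *: (b1 * S b2).
      have := @sw_antr k H _ (fun z => b1 * (z * S b2)) d; rewrite mul1r => <-; last by linp.
      by apply: eq_sw => d1 d2; rewrite !mulrA.
    over.
  by rewrite swZ (@sw_antr k H _ (fun z => z)) ?scalerA ?[eps d * _]mulrC //; linp.
transitivity (sw (fun a b => sw (fun c d => S (a * c) * sw (fun b1 b2 =>
    sw (fun d1 d2 => b1 * d1 * (S d2 * S b2)) d) b) y) x).
  under [RHS]eq_sw => a b.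
    under eq_sw => c d do rewrite U -scalerA -!scalerAr mulr1.
    rewrite swZ (@sw_counitr k H _ (fun c => S (a * c))); last by linp.
    over.
  by rewrite (@sw_counitr k H _ (fun a => S (a * y))) //; linp.
transitivity (sw (fun a b => sw (fun b1 b2 => sw (fun c d => sw (fun d1 d2 =>
   S (a * c) * (b1 * d1 * (S d2 * S b2))) d) y) b) x).
  apply: eq_sw => a b; rewrite sw_swap; apply: eq_sw => c d.
  rewrite (@sw_out _ _ _ _ (fun z => S (a * c) * z)); last by linp.
  by apply: eq_sw => b1 b2; rewrite (@sw_out _ _ _ _ (fun z => S (a * c) * z)) //; linp.
rewrite -swA; [|linp|linp|linp].
transitivity (sw (fun a b => eps a *: (S y * S b)) x); last first.
  by rewrite sw_counitl //; linp.
apply: eq_sw => a b.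
under eq_sw => a1 a2.
  rewrite -swA; [|linp|linp|linp].
  over.
rewrite sw_swap.
transitivity (sw (fun c d => eps c *: (eps a *: (S d * S b))) y); last first.
  by rewrite sw_counitl //; linp.
apply: eq_sw => c d.
rewrite scalerA mulrC -counitM.
have := @sw_antl k H _ (fun z => z * (S d * S b)) (a * c); rewrite mul1r => <-; last by linp.
rewrite swM; last by linp.
by do 2!(apply: eq_sw => ? ?); rewrite !mulrA.
Qed.

Lemma comul_antipode W (f : H -> H -> W) x : bil f ->
  sw f (S x) = sw (fun a b => f (S b) (S a)) x.
Proof.
move=> hf.
have V1 p q b : sw (fun b1 b2 => sw (fun u v => sw (fun v' d =>
    f (p * u * S d) (q * (v * S v'))) b2) b1) b = eps b *: f p q.
  transitivity (sw (fun u b' => sw (fun b2 d => sw (fun v v' =>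
     f (p * u * S d) (q * (v * S v'))) b2) b') b).
    rewrite swA; [|linp|linp|linp].
    by apply: eq_sw => u b'; rewrite swA //; linp.
  under eq_sw => u b'.
    under eq_sw => b2 d.
      rewrite (@sw_antr k H _ (fun z => f (p * u * S d) (q * z))); last by linp.
      over.
    rewrite (@sw_counitl k H _ (fun d => f (p * u * S d) (q * 1))); last by linp.
    rewrite mulr1 -mulrA; over.
  by rewrite (@sw_antr k H _ (fun z => f (p * z) q)) ?mulr1 //; linp.
transitivity (sw (fun a b => sw (fun p q => sw (fun b1 b2 => sw (fun u v => sw (fun v' d =>
    f (p * u * S d) (q * (v * S v'))) b2) b1) b) (S a)) x).
  under [RHS]eq_sw => a b.
    under eq_sw => p q do rewrite V1.
    rewrite swZ; over.
  by rewrite (@sw_counitr k H _ (fun a => sw f (S a))) //; linp.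
transitivity (sw (fun a b => sw (fun b1 b2 => sw (fun p q => sw (fun u v => sw (fun v' d =>
    f (p * u * S d) (q * v * S v')) b2) b1) (S a)) b) x).
  apply: eq_sw => a b; rewrite sw_swap; do 3! apply: eq_sw => ? ?.
  by apply: eq_sw => ? ?; rewrite mulrA.
rewrite -swA; [|linp|linp|linp].
under eq_sw => a b.
  have -> : sw (fun a b1 => sw (fun p q => sw (fun u v => sw (fun v' d =>
    f (p * u * S d) (q * v * S v')) b) b1) (S a)) a =
    eps a *: sw (fun v' d => f (S d) (S v')) b.
    pose F z := sw (fun p q => sw (fun v' d => f (p * S d) (q * S v')) b) z.
    have -> : sw (fun v' d => f (S d) (S v')) b = F 1.
      rewrite /F sw1; last by linp.
      by apply: eq_sw => ? ?; rewrite !mul1r.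
    rewrite -(@sw_antl k H _ F a); last by rewrite /F; linp.
    by apply: eq_sw => a1 a2; rewrite /F swM //; linp.
  over.
by rewrite (@sw_counitl k H _ (fun b => sw (fun v' d => f (S d) (S v')) b)) //; linp.
Qed.

Lemma counit_antipode x : eps (S x) = eps x.
Proof.
have := congr1 eps (antipodel x).
rewrite (slin_sumE (@counit_lin _ H)) (slinZ (@counit_lin _ H)) counit1 mulr1 => <-.
rewrite -{1}(comul_counitr x) lin_sumE; last exact: antipode_lin.
rewrite (slin_sumE (@counit_lin _ H)); apply: eq_bigr => p _.
by rewrite (linZ (@antipode_lin _ H)) (slinZ (@counit_lin _ H)) counitM mulrC.
Qed.

Lemma left_integral_casimir (K : {pred H}) W (f : H -> H -> W) (L h : H) :
  bil f -> {in K, forall x, tens_in K (comul x)} ->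
  {in K, forall x, x * L = eps x *: L} -> h \in K ->
  sw (fun a b => f (h * a) (S b)) L = sw (fun a b => f a (S b * h)) L.
Proof.
move=> hf hK hL hh.
transitivity (sw (fun u v => sw (fun p q => f p (S q * v)) (u * L)) h); last first.
  rewrite (@eq_sw_in k H K _ _ (fun u v => eps u *: sw (fun p q => f p (S q * v)) L)).
  - by rewrite (@sw_counitl k H _ (fun v => sw (fun p q => f p (S q * v)) L)) //; linp.
  - by linp.
  - by linp.
  - exact: hK.
  - by move=> a b ha hb; rewrite hL // linZ //; linp.
transitivity (sw (fun u v => sw (fun u1 u2 => sw (fun a b =>
   f (u1 * a) (S b * (S u2 * v))) L) u) h); last first.
  apply: eq_sw => u v; rewrite swM; last by linp.
  by do 2!(apply: eq_sw => ? ?); rewrite antipodeM mulrA.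
rewrite swA; [|linp|linp|linp].
under [RHS]eq_sw => u v.
  rewrite (@sw_antl k H _ (fun z => sw (fun a b => f (u * a) (S b * z)) L)); last by linp.
  over.
rewrite (@sw_counitr k H _ (fun u => sw (fun a b => f (u * a) (S b * 1)) L)); last by linp.
by apply: eq_sw => a b; rewrite mulr1.
Qed.

Lemma right_integral_casimir W (f : H -> H -> W) (L h : H) :
  bil f -> (forall x, L * x = eps x *: L) ->
  sw (fun a b => f (a * h) b) L = sw (fun a b => f a (b * S h)) L.
Proof.
move=> hf hL.
transitivity (sw (fun u v => sw (fun p q => f p (q * S v)) (L * u)) h); last first.
  under eq_sw => u v.
    rewrite hL linZ; last by linp.
    over.
  by rewrite (@sw_counitl k H _ (fun v => sw (fun p q => f p (q * S v)) L)) //; linp.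
transitivity (sw (fun u v => sw (fun u1 u2 => sw (fun a b =>
   f (a * u1) (b * (u2 * S v))) L) u) h); last first.
  apply: eq_sw => u v; rewrite swM; last by linp.
  by rewrite sw_swap; do 2!(apply: eq_sw => ? ?); rewrite mulrA.
rewrite swA; [|linp|linp|linp].
under [RHS]eq_sw => u v.
  rewrite (@sw_antr k H _ (fun z => sw (fun a b => f (a * u) (b * z)) L)); last by linp.
  over.
rewrite (@sw_counitr k H _ (fun u => sw (fun a b => f (a * u) (b * 1)) L)); last by linp.
by apply: eq_sw => a b; rewrite mulr1.
Qed.

End Antipode.

(** * Bases of finite-dimensional spaces *)

Section FiniteDimension.
Variables (k : fieldType).
Implicit Types (V W : lmodType k).

Lemma separating_functional V (v : V) : v <> 0 -> exists2 t : V -> k, slin t & t v = 1.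
Proof.
move=> v0.
pose P (M : set V) := (forall c u w, M u -> M w -> M (c *: u + w)) /\ ~ M v.
have [|A [[Acl Av] Amax]] := @Zorn_bigcup V P.
  move=> F FP tot; split; last by case=> X FX Xv; exact: (FP _ FX).2.
  move=> c u w [X FX Xu] [Y FY Yw].
  have [XY|YX] := tot _ _ FX FY.
    by exists Y => //; apply: (FP _ FY).1 => //; exact: XY.
  by exists X => //; apply: (FP _ FX).1 => //; exact: YX.
have A0 : A 0.
  apply: contrapT => nA0; apply: (Amax (fun x => x = 0)).
    split; last by move=> h; apply: nA0; apply: h.
    move=> x Ax; exfalso; apply: nA0.
    by have := Acl (-1) x x Ax Ax; rewrite scaleN1r addNr.
  by split=> [c u w -> ->|//]; rewrite scaler0 addr0.
have AZ c u : A u -> A (c *: u) by move=> Au; rewrite -[_ *: _]addr0; apply: Acl.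
have AB u w : A u -> A w -> A (u - w).
  by move=> Au Aw; rewrite addrC -scaleN1r; apply: Acl.
have ex u : exists c, A (u - c *: v).
  have [Au|nAu] := pselect (A u); first by exists 0; rewrite scale0r subr0.
  have [Bv|nBv] := pselect (exists a c, A a /\ v = c *: u + a); last first.
    exfalso; apply: (Amax (fun w => exists a c, A a /\ w = c *: u + a)).
      split; last by move=> h; apply: nAu; apply: h; exists 0, 1; rewrite scale1r addr0.
      by move=> x Ax; exists x, 0; rewrite scale0r add0r.
    split=> // c _ _ [a1 [c1 [Aa1 ->]]] [a2 [c2 [Aa2 ->]]].
    exists (c *: a1 + a2), (c * c1 + c2); split; first exact: Acl.
    by rewrite scalerDr scalerA scalerDl addrACA.
  have [a [c [Aa ev]]] := Bv.
  have c0 : c != 0.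
    by apply/eqP => c0; apply: Av; rewrite ev c0 scale0r add0r.
  exists c^-1; rewrite ev scalerDr scalerA mulVf // scale1r opprD addrA subrr sub0r.
  by rewrite -scaleNr; apply: AZ.
have uni u c d : A (u - c *: v) -> A (u - d *: v) -> c = d.
  move=> h1 h2; apply/eqP; rewrite -subr_eq0; apply/negPn/negP => cd.
  apply: Av; have := AZ (c - d)^-1 _ (AB _ _ h2 h1).
  have -> : u - d *: v - (u - c *: v) = (c - d) *: v.
    by rewrite opprB addrC addrA subrK scalerBl.
  by rewrite scalerA mulVf ?scale1r.
have [t tP] := choice ex; exists t.
  move=> c u w; apply: (uni (c *: u + w)); first exact: tP.
  have := Acl c _ _ (tP u) (tP w).
  by rewrite scalerBr scalerA addrACA -opprD -scalerDl.
by apply: (uni v); [exact: tP | rewrite scale1r subrr].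
Qed.

Definition biorth V (I : finType) (e : I -> V) (c : I -> V -> k) :=
  (forall i, slin (c i)) /\ (forall i j, c i (e j) = (i == j)%:R).

Definition basis_on V (P : {pred V}) (I : finType) (e : I -> V) (c : I -> V -> k) :=
  [/\ biorth e c, forall i, e i \in P & {in P, forall x, x = \sum_i c i x *: e i}].

Definition subspace V (P : {pred V}) :=
  0 \in P /\ forall c, {in P &, forall x y, c *: x + y \in P}.

Lemma subspace_sum V (P : {pred V}) I (r : seq I) (Q : pred I) (F : I -> V) :
  subspace P -> (forall i, Q i -> F i \in P) -> \sum_(i <- r | Q i) F i \in P.
Proof.
case=> P0 Pcl h; elim/big_ind: _ => // x y hx hy.
by rewrite -[x]scale1r; apply: Pcl.
Qed.

Lemma subspaceZ V (P : {pred V}) c x : subspace P -> x \in P -> c *: x \in P.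
Proof. by case=> P0 Pcl h; rewrite -[_ *: _]addr0; apply: Pcl. Qed.

Lemma subspaceB V (P : {pred V}) x y : subspace P -> x \in P -> y \in P -> x - y \in P.
Proof. by case=> P0 Pcl hx hy; rewrite addrC -scaleN1r; apply: Pcl. Qed.

Lemma biorth_bound V n m (e : 'I_n -> V) c (s : 'I_m -> V) : biorth e c ->
  (forall i, exists M : 'I_m -> k, e i = \sum_j M j *: s j) -> (n <= m)%N.
Proof.
move=> [cl ce] /choice[M eM].
pose A := \matrix_(i < n, j < m) M i j; pose B := \matrix_(j < m, i < n) c i (s j).
have AB : A *m B = 1%:M.
  apply/matrixP => i l; rewrite !mxE -[RHS]/((i == l)%:R) eq_sym -ce eM slin_sumE //.
  by apply: eq_bigr => j _; rewrite !mxE slinZ.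
by rewrite -(mxrank1 k n) -AB (leq_trans (mxrankM_maxr _ _)) ?rank_leq_row.
Qed.

Lemma exists_basis_on V (P : {pred V}) m (s : 'I_m -> V) : subspace P ->
  {in P, forall x, exists M : 'I_m -> k, x = \sum_j M j *: s j} ->
  exists n (e : 'I_n -> V) c, basis_on P e c.
Proof.
move=> sP spanP; apply: contrapT => nex.
have ext n : exists (e : 'I_n -> V) (c : 'I_n -> V -> k), biorth e c /\ forall i, e i \in P.
  elim: n => [|n [e [c [[cl ce] eP]]]].
    by exists (fun=> 0), (fun _ _ => 0); split; [split; case | case].
  have [x [xP xn]] : exists x, x \in P /\ x <> \sum_i c i x *: e i.
    apply: contrapT => nx; apply: nex; exists n, e, c; split=> // x xP.
    by apply: contrapT => xn; apply: nx; exists x.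
  pose x' := x - \sum_i c i x *: e i.
  have cx' i : c i x' = 0.
    rewrite /x' slinB // slin_sumE // (bigD1 i) //= slinZ // ce eqxx mulr1.
    by rewrite big1 ?addr0 ?subrr // => j ji; rewrite slinZ // ce eq_sym (negPf ji) mulr0.
  have [|t tl tx] := @separating_functional V x'.
    by move/eqP; rewrite subr_eq0 => /eqP.
  pose t' z := t z - \sum_i t (e i) * c i z.
  have t'l : slin t'.
    by rewrite /t'; linp.
  have t'x : t' x' = 1 by rewrite /t' tx big1 ?subr0 // => i _; rewrite cx' mulr0.
  have t'e i : t' (e i) = 0.
    rewrite /t' (bigD1 i) //= ce eqxx mulr1 big1 ?addr0 ?subrr // => j ji.
    by rewrite ce (negPf ji) mulr0.
  exists (fun i => if unlift ord0 i is Some j then e j else x').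
  exists (fun i => if unlift ord0 i is Some j then c j else t'); split; last first.
    move=> i; case: unliftP => [j _|_] //; apply: subspaceB => //.
    by apply: subspace_sum => // j _; apply: subspaceZ.
  split=> [i|i j]; first by case: unliftP => [j _|_].
  case: unliftP => [i' ->|->]; case: unliftP => [j' ->|->].
  - by rewrite ce (inj_eq lift_inj).
  - by rewrite cx' eq_sym (negPf (neq_lift _ _)).
  - by rewrite t'e (negPf (neq_lift _ _)).
  - by rewrite t'x eqxx.
have [e [c [bi eP]]] := ext m.+1.
suff : (m.+1 <= m)%N by rewrite ltnn.
exact: (biorth_bound bi (fun i => spanP _ (eP i))).
Qed.

Lemma span_subspace V m (s : 'I_m -> V) :
  subspace [pred x | `[< exists M : 'I_m -> k, x = \sum_j M j *: s j >]].
Proof.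
split=> [|c x y].
  by rewrite inE; exists (fun _ => 0); rewrite big1 // => i _; rewrite scale0r.
rewrite !inE => -[M ->] [N ->].
exists (fun j => c * M j + N j); rewrite scaler_sumr -big_split.
by apply: eq_bigr => j _; rewrite scalerDl scalerA.
Qed.

Lemma exists_basis_span V m (s : 'I_m -> V) : exists n (e : 'I_n -> V) c,
  biorth e c /\ forall j, s j = \sum_i c i (s j) *: e i.
Proof.
have [|n [e [c [bi _ eP]]]] := @exists_basis_on V _ m s (span_subspace s).
  by move=> x; rewrite inE.
exists n, e, c; split=> // j; apply: eP; rewrite inE.
exists (fun i => (i == j)%:R); rewrite (bigD1 j) //= eqxx scale1r big1 ?addr0 // => i /negPf ->.
by rewrite scale0r.
Qed.

End FiniteDimension.

Section Traces.
Variables (k : fieldType).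
Implicit Types (V W : lmodType k).

Definition full_basis V (I : finType) (e : I -> V) (c : I -> V -> k) :=
  biorth e c /\ forall x, x = \sum_i c i x *: e i.

Definition tr V (I : finType) (e : I -> V) (c : I -> V -> k) (f : V -> V) :=
  \sum_i c i (f (e i)).

Lemma eq_tr V (I : finType) (e : I -> V) c f g : f =1 g -> tr e c f = tr e c g.
Proof. by move=> fg; apply: eq_bigr => i _; rewrite fg. Qed.

Lemma trC V W (I J : finType) (e : I -> V) c (e' : J -> W) c' (f : V -> W) (g : W -> V) :
  full_basis e c -> full_basis e' c' -> lin f -> lin g ->
  tr e c (fun x => g (f x)) = tr e' c' (fun x => f (g x)).
Proof.
move=> [[cl _] ex] [[cl' _] ex'] fl gl; rewrite /tr.
under eq_bigr => i _.
  rewrite [f (e i)]ex' lin_sumE // slin_sumE //.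
  under eq_bigr do rewrite linZ // slinZ //; over.
rewrite exchange_big; apply: eq_bigr => j _ /=.
rewrite [g (e' j) in RHS]ex lin_sumE // slin_sumE //.
by apply: eq_bigr => i _; rewrite linZ // slinZ // mulrC.
Qed.

Lemma basis_enum V (I : finType) (e : I -> V) c : full_basis e c ->
  full_basis (fun i : 'I_#|I| => e (enum_val i)) (fun i => c (enum_val i)).
Proof.
move=> [[cl ce] ex]; split; first split=> [i|i j]; rewrite ?ce //.
  by rewrite (inj_eq enum_val_inj).
move=> x; rewrite [LHS]ex (reindex _ (onW_bij _ (@enum_val_bij I))) /=.
by [].
Qed.

Lemma tr_enum V (I : finType) (e : I -> V) c f : 
  tr e c f = tr (fun i : 'I_#|I| => e (enum_val i)) (fun i => c (enum_val i)) f.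
Proof. by rewrite /tr (reindex _ (onW_bij _ (@enum_val_bij I))). Qed.

Section Matrix.
Variables (V : lmodType k) (n : nat) (e : 'I_n -> V) (c : 'I_n -> V -> k).
Hypothesis ec : full_basis e c.

Definition mxf (f : V -> V) := \matrix_(i < n, j < n) c j (f (e i)).
Definition rv x := \row_(j < n) c j x.

Lemma rv_mxf f x : lin f -> rv (f x) = rv x *m mxf f.
Proof.
move=> fl; apply/rowP => j; rewrite !mxE {1}[x]ec.2 lin_sumE // slin_sumE; last exact: ec.1.1.
by apply: eq_bigr => i _; rewrite !mxE linZ // slinZ //; apply: ec.1.1.
Qed.

Lemma rv_inj : injective rv.
Proof.
move=> x y /rowP xy; rewrite [x]ec.2 [y]ec.2; apply: eq_bigr => i _.
by have := xy i; rewrite !mxE => ->.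
Qed.

Lemma mxf_comp f g : lin f -> lin g -> mxf (fun x => g (f x)) = mxf f *m mxf g.
Proof.
move=> fl gl; apply/row_matrixP => i; rewrite row_mul.
have rowE h : row i (mxf h) = rv (h (e i)) by apply/rowP => j; rewrite !mxE.
by rewrite !rowE rv_mxf.
Qed.

Lemma mxf_id : mxf (fun x => x) = 1%:M.
Proof. by apply/matrixP => i j; rewrite !mxE ec.1.2 eq_sym. Qed.

Lemma tr_mxf f : tr e c f = \tr (mxf f).
Proof. by apply: eq_bigr => i _; rewrite mxE. Qed.

Lemma lin_inj_bij f : lin f -> injective f ->
  exists g : V -> V, [/\ lin g, cancel f g & cancel g f].
Proof.
move=> fl finj.
pose vec (r : 'rV[k]_n) := \sum_i r 0 i *: e i.
have rvK x : vec (rv x) = x.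
  by rewrite [RHS]ec.2; apply: eq_bigr => i _; rewrite mxE.
have vecK r : rv (vec r) = r.
  apply/rowP => j; rewrite mxE slin_sumE; last exact: ec.1.1.
  rewrite (bigD1 j) //= slinZ ?ec.1.2 ?eqxx ?mulr1; last exact: ec.1.1.
  rewrite big1 ?addr0 // => i /negPf ij; rewrite slinZ; last exact: ec.1.1.
  by rewrite ec.1.2 eq_sym ij mulr0.
have vecl : lin vec.
  move=> d u v; rewrite /vec scaler_sumr -big_split; apply: eq_bigr => i _.
  by rewrite !mxE scalerDl scalerA.
have rvl d u v : rv (d *: u + v) = d *: rv u + rv v.
  by apply/rowP => j; rewrite !mxE; apply: ec.1.1.
have fu : mxf f \in unitmx.
  rewrite -row_free_unit -kermx_eq0; apply/eqP/row_matrixP => i; rewrite row0.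
  set r := row i _.
  have rf : r *m mxf f = 0 by apply/sub_kermxP; exact: row_sub.
  have rv0 : rv 0 = 0 by apply/rowP => j; rewrite !mxE slin0 //; apply: ec.1.1.
  rewrite -(vecK r); have -> : vec r = 0.
    by apply: finj; apply: rv_inj; rewrite !rv_mxf // vecK rf rv0 mul0mx.
  by rewrite rv0.
exists (fun y => vec (rv y *m invmx (mxf f))); split.
- move=> d u v; rewrite -vecl; congr vec; rewrite rvl mulmxDl.
  by rewrite scalemxAl.
- by move=> x; rewrite rv_mxf // mulmxK.
- by move=> x; apply: rv_inj; rewrite rv_mxf // vecK mulmxKV.
Qed.

End Matrix.

Lemma mx_idem_trace m (A : 'M[k]_m) : A *m A = A -> \tr A = (\rank A)%:R.
Proof.
move=> AA; rewrite -{1}(mulmx_base A) mxtrace_mulC.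
have := mulmx_base A; move: (row_base_free A) (col_base_full A).
move: (row_base A) (col_base A) => R C fR fC CR.
suff -> : R *m C = 1%:M by rewrite mxtrace1.
apply: (row_free_inj fR); apply: (row_full_inj fC).
by rewrite mul1mx !mulmxA CR -mulmxA CR.
Qed.

Lemma tr_idem V (I : finType) (e : I -> V) c f : full_basis e c -> lin f ->
  (forall x, f (f x) = f x) ->
  exists r : nat, [/\ tr e c f = r%:R, (r <= #|I|)%N & r = 0%N -> forall x, f x = 0].
Proof.
move=> /basis_enum ec fl ff; rewrite tr_enum.
exists (\rank (mxf (fun i : 'I_#|I| => e (enum_val i)) (fun i => c (enum_val i)) f)); split.
- rewrite tr_mxf mx_idem_trace // -(mxf_comp ec) //.
  by apply/matrixP => i j; rewrite !mxE ff.
- exact: rank_leq_row.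
move/eqP; rewrite mxrank_eq0 => /eqP f0 x; apply: (rv_inj ec).
rewrite (rv_mxf ec) // f0 mulmx0; apply/rowP => j.
by rewrite !mxE slin0 //; apply: ec.1.1.
Qed.

Lemma tr_id V (I : finType) (e : I -> V) c : full_basis e c ->
  tr e c (fun x => x) = #|I|%:R.
Proof.
move=> [[_ ce] _]; rewrite /tr; under eq_bigr do rewrite ce eqxx.
by rewrite sumr_const.
Qed.

Section DualBasis.
Variables (A : algType k) (P : {pred A}) (n : nat) (e : 'I_n -> A) (c : 'I_n -> A -> k).
Variable (T : A -> k).
Hypotheses (sP : subspace P) (ec : basis_on P e c) (Tl : slin T).
Hypothesis Tn : {in P, forall a, {in P, forall b, T (a * b) = 0} -> a = 0}.

Lemma exists_dual_basis : exists q : 'I_n -> A,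
  [/\ forall l, q l \in P,
      {in P, forall a, \sum_l T (q l * a) *: e l = a},
      {in P, forall a, \sum_l T (a * e l) *: q l = a}
    & forall i j, T (q i * e j) = (i == j)%:R].
Proof.
have [[cl ce] eP ex] := ec.
pose G := \matrix_(i < n, j < n) T (e i * e j).
have Gu : G \in unitmx.
  rewrite -row_free_unit -kermx_eq0; apply/eqP/row_matrixP => i; rewrite row0.
  set r := row i _.
  have rG : r *m G = 0 by apply/sub_kermxP; exact: row_sub.
  pose a := \sum_j r 0 j *: e j.
  have aP : a \in P by apply: subspace_sum => // j _; apply: subspaceZ.
  have a0 : a = 0.
    apply: Tn => // b bP; rewrite (ex b) // mulr_sumr slin_sumE // big1 // => j _.
    rewrite -scalerAr slinZ // mulr_suml slin_sumE //.
    have /rowP/(_ j) := rG; rewrite !mxE => e0.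
    rewrite (_ : \sum_i0 _ = 0) ?mulr0 // -[RHS]e0; apply: eq_bigr => l _.
    by rewrite !mxE -scalerAl slinZ.
  apply/rowP => j; rewrite [RHS]mxE -(slin0 (cl j)) -a0 slin_sumE // (bigD1 j) //=.
  rewrite slinZ // ce eqxx mulr1 big1 ?addr0 // => l /negPf lj.
  by rewrite slinZ // ce eq_sym lj mulr0.
pose q i := \sum_j invmx G i j *: e j.
have qP l : q l \in P by apply: subspace_sum => // j _; apply: subspaceZ.
have qe i j : T (q i * e j) = (i == j)%:R.
  have /matrixP/(_ i j) := mulVmx Gu; rewrite !mxE => <-.
  rewrite mulr_suml slin_sumE //; apply: eq_bigr => l _.
  by rewrite mxE -scalerAl slinZ.
have h1 : {in P, forall a, \sum_l T (q l * a) *: e l = a}.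
  move=> a aP; rewrite [RHS]ex //; apply: eq_bigr => l _; congr (_ *: _).
  rewrite (ex a aP) mulr_sumr slin_sumE // (bigD1 l) //= -scalerAr slinZ // qe eqxx mulr1.
  rewrite big1 ?addr0; last first.
    by move=> j /negPf jl; rewrite -scalerAr slinZ // qe eq_sym jl mulr0.
  by rewrite -ex.
exists q; split=> // a aP; apply/eqP; rewrite -subr_eq0; apply/eqP.
have sumP : \sum_l T (a * e l) *: q l \in P.
  by apply: subspace_sum => // l _; apply: subspaceZ.
apply: Tn; first exact: subspaceB.
move=> b bP; rewrite mulrBl slinB // mulr_suml slin_sumE //.
rewrite -{2}(h1 b bP) mulr_sumr slin_sumE //; apply/eqP; rewrite subr_eq0; apply/eqP.
apply: eq_bigr => l _; rewrite -scalerAl -scalerAr !slinZ //.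
by rewrite mulrC.
Qed.
End DualBasis.

Section Fitting.
Variables (A : algType k) (n : nat) (e : 'I_n -> A) (c : 'I_n -> A -> k).
Hypothesis ec : full_basis e c.

Lemma annihilating_poly (a : A) : exists2 p : {poly k}, p != 0 & horner_alg a p = 0.
Proof.
pose N := \matrix_(i < n.+1, j < n) c j (a ^+ i).
have : kermx N != 0.
  rewrite -mxrank_eq0 mxrank_ker -lt0n subn_gt0.
  by rewrite (leq_ltn_trans (rank_leq_col N)).
case/rowV0Pn => v /sub_kermxP vN v0.
exists (\poly_(i < n.+1) v 0 (inord i)).
  apply: contra v0 => /eqP p0; apply/eqP/rowP => i; rewrite mxE.
  have : (\poly_(i < n.+1) v 0 (inord i))`_i = 0 by rewrite p0 coef0.
  by rewrite coef_poly ltn_ord inord_val.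
rewrite poly_def linear_sum /=; apply: (rv_inj ec).
apply/rowP => j; have /rowP/(_ j) := vN; rewrite !mxE (slin0 (ec.1.1 j)) => <-.
rewrite slin_sumE; last exact: ec.1.1.
apply: eq_bigr => i _; rewrite linearZ /= rmorphXn /= horner_algX inord_val.
by rewrite mxE mulr_algl slinZ //; apply: ec.1.1.
Qed.

(* Fitting's lemma: [a] is invertible on the image of the idempotent
   horner_alg a (u * 'X^(s.+1)) and nilpotent on the complementary one. *)
Lemma fitting_idempotent (a : A) : exists (s : nat) (u : {poly k}),
  let f := horner_alg a (u * 'X^(s.+1)) in
  f * f = f /\ a ^+ s.+1 = a ^+ s.+1 * f.
Proof.
have [p p0 pa] := annihilating_poly a.
have [s [q]] := multiplicity_XsubC p 0; rewrite p0 /= polyC0 subr0 => rq pE.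
have : coprimep 'X^(s.+1) q.
  by rewrite coprimep_sym; apply: coprimep_expr; rewrite -['X]subr0 -polyC0 coprimep_XsubC.
move=> /Bezout_eq1_coprimepP [[u v] /= uv]; exists s, u.
have qa : horner_alg a (q * 'X^(s.+1)) = 0.
  by rewrite exprSr mulrA -pE rmorphM /= pa mul0r.
have E : 1 - u * 'X^(s.+1) = v * q by rewrite -uv [u * _ + _]addrC addrK.
have Z w : horner_alg a (w * (q * 'X^(s.+1))) = 0 by rewrite rmorphM /= qa mulr0.
split.
  apply/eqP; rewrite eq_sym -subr_eq0 -rmorphM -rmorphB /= -{1}[u * _]mulr1 -mulrBr E.
  by rewrite -(Z (u * v)); apply/eqP; congr (horner_alg a _); rewrite -!mulrA; congr (_ * _); rewrite mulrC -mulrA.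
have -> : a ^+ s.+1 = horner_alg a 'X^(s.+1) by rewrite rmorphXn /= horner_algX.
apply/eqP; rewrite -subr_eq0 -rmorphM -rmorphB /= -{1}['X^_]mulr1 -mulrBr E.
by rewrite -(Z v); apply/eqP; congr (horner_alg a _); rewrite mulrC -mulrA.
Qed.

End Fitting.
End Traces.

(** * Positivity at roots of unity *)

Import Order.TTheory Num.Theory.

Section Positivity.
Variables (M s : nat) (m : 'I_s -> 'I_M -> nat) (w : 'I_s -> nat).
Hypothesis w_gt0 : forall i, (0 < w i)%N.
Variables (i0 : 'I_s) (j0 : 'I_M).
Hypothesis m0 : forall j, m i0 j = (j == j0).

(* As z ^+ M = 1, the exponent M - j stands for - j. *)
Definition twisted_sum (F : comNzRingType) (z : F) := \sum_i (w i)%:R *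
  ((\sum_j (m i j)%:R * z ^+ j) * (\sum_j (m i j)%:R * z ^+ (M - j))).

Lemma twisted_sum_neq0 (z : algC) : z ^+ M = 1 -> twisted_sum z != 0.
Proof.
move=> zM.
have z0 : z != 0.
  by apply/eqP => z0; have := zM; rewrite z0 expr0n gtn_eqF ?(leq_ltn_trans _ (ltn_ord j0)) // => /esym/eqP; rewrite oner_eq0.
have nz : `|z| = 1.
  apply/eqP; rewrite -(@pexpr_eq1 _ _ M) ?(leq_ltn_trans _ (ltn_ord j0)) //.
  by rewrite -normrX zM normr1.
have zc j : (j <= M)%N -> z ^+ (M - j) = (z ^+ j)^*.
  move=> jM; apply: (mulfI (expf_neq0 j z0)); rewrite -exprD subnKC // zM.
  by rewrite -normCK normrX nz !expr1n.
have E i : \sum_j (m i j)%:R * z ^+ (M - j) = (\sum_(j < M) (m i j)%:R * z ^+ j)^*.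
  by rewrite rmorph_sum; apply: eq_bigr => j _; rewrite rmorphM rmorph_nat zc // ltnW.
rewrite /twisted_sum; under eq_bigr do rewrite E -normCK.
rewrite gt_eqF // (bigD1 i0) //= ltr_pwDl //.
  rewrite mulr_gt0 ?ltr0n // exprn_gt0 // (bigD1 j0) //= m0 eqxx mul1r big1 ?addr0.
    by rewrite normrX nz expr1n.
  by move=> j /negPf jj; rewrite m0 jj mul0r.
by apply: sumr_ge0 => i _; rewrite mulr_ge0 ?exprn_ge0 // ler0n.
Qed.

(* The polynomial version of [twisted_sum] is prime to X^M - 1 over algC, hence
   over rat, and a Bezout relation can be evaluated in any field. *)
Lemma twisted_sum_neq0_pchar0 (k : fieldType) (z : k) : [pchar k] =i pred0 ->
  z ^+ M = 1 -> twisted_sum z != 0.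
Proof.
move=> /pcharf0P ch zM.
pose Q := twisted_sum ('X : {poly int}).
have QE (F : comNzRingType) (x : F) : (map_poly intr Q).[x] = twisted_sum x.
  rewrite /Q /twisted_sum rmorph_sum horner_sum; apply: eq_bigr => i _.
  rewrite !rmorphM !rmorph_nat !hornerM -polyC_natr hornerC; congr (_ * (_ * _)).
    rewrite rmorph_sum horner_sum; apply: eq_bigr => j _.
    by rewrite rmorphM rmorph_nat /= map_polyXn hornerM -polyC_natr hornerC hornerXn.
  rewrite rmorph_sum horner_sum; apply: eq_bigr => j _.
  by rewrite rmorphM rmorph_nat /= map_polyXn hornerM -polyC_natr hornerC hornerXn.
have : coprimep (map_poly intr Q : {poly rat}) ('X^M - 1).
  rewrite -(coprimep_map (ratr : rat -> algC)) coprimep_sym.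
  apply: Pdiv.ClosedField.root_coprimep => x.
  rewrite rmorphB rmorph1 /= map_polyXn rootE !hornerE subr_eq0 => /eqP xM.
  rewrite -map_poly_comp (eq_map_poly (g := intr)); last by move=> i /=; rewrite ratr_int.
  by rewrite QE twisted_sum_neq0.
move=> /Bezout_eq1_coprimepP [[u v] /= uv].
have [u' [a a0 uE]] := rat_poly_scale u; have [v' [b b0 vE]] := rat_poly_scale v.
have uv' : (b%:P * u') * Q + (a%:P * v') * ('X^M - 1) = (a * b)%:P.
  have inj : injective (map_poly (intr : int -> rat)) by apply: map_inj_poly => //; apply: intr_inj.
  apply: inj; rewrite rmorphD !rmorphM rmorphB rmorph1 /= map_polyXn !map_polyC /=.
  have -> : map_poly intr u' = (a%:~R)%:P * u.
    by rewrite uE mul_polyC scalerA divff ?intr_eq0 // scale1r.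
  have -> : map_poly intr v' = (b%:~R)%:P * v.
    by rewrite vE mul_polyC scalerA divff ?intr_eq0 // scale1r.
  by rewrite -[RHS]mulr1 -[X in _ = _ * X]uv [RHS]mulrDr !mulrA [b%:~R%:P * a%:~R%:P]mulrC.
have := congr1 (fun p => (map_poly (intr : int -> k) p).[z]) uv'.
rewrite /= rmorphD !rmorphM rmorphB rmorph1 /= map_polyXn !map_polyC /= !hornerE QE zM subrr mulr0 addr0.
move=> e; apply: contra_eq_neq e => ->; rewrite mulr0 eq_sym.
have intr0 (i : int) : i != 0 -> (i%:~R : k) != 0.
  case: i => n; first by rewrite -pmulrn ch.
  by move=> _; rewrite NegzE rmorphN oppr_eq0 /= -pmulrn ch.
by rewrite mulf_neq0 ?intr0.
Qed.

End Positivity.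

(** * Dual bases and the regular trace *)

Section DualBases.
Variables (k : fieldType) (A : algType k).
Implicit Types (W : lmodType k) (P : {pred A}) (T : A -> k).

Definition dual_bases P T n (e q : 'I_n -> A) :=
  [/\ (forall l, e l \in P) /\ (forall l, q l \in P),
      {in P, forall a, \sum_l T (q l * a) *: e l = a},
      {in P, forall a, \sum_l T (a * e l) *: q l = a}
    & forall i j, T (q i * e j) = (i == j)%:R].

Variables (P : {pred A}) (T : A -> k) (n : nat) (e q : 'I_n -> A).
Hypotheses (Tl : slin T) (D : dual_bases P T e q).

Lemma dual_bases_casimir W (f : A -> A -> W) x : bil f -> {in P &, forall a b, a * b \in P} ->
  x \in P -> \sum_l f (x * e l) (q l) = \sum_l f (e l) (q l * x).
Proof.
move=> [fl fr] PM xP; have [[eP qP] D1 D2 _] := D.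
under eq_bigr => l _.
  rewrite -(D1 (x * e l)) ?PM // (lin_sumE (fl _)).
  under eq_bigr do rewrite (linZ (fl _)); over.
rewrite exchange_big; apply: eq_bigr => j _ /=.
rewrite -[in RHS](D2 (q j * x)) ?PM // (lin_sumE (fr _)).
by apply: eq_bigr => l _; rewrite (linZ (fr _)) mulrA.
Qed.

Lemma dual_bases_sym W (f : A -> A -> W) : bil f -> {in P &, forall a b, T (a * b) = T (b * a)} ->
  \sum_l f (e l) (q l) = \sum_l f (q l) (e l).
Proof.
move=> [fl fr] TC; have [[eP qP] D1 D2 _] := D.
under eq_bigr => l _.
  rewrite -[X in f _ X](D1 (q l)) // (lin_sumE (fr _)).
  under eq_bigr do rewrite (linZ (fr _)); over.
rewrite exchange_big; apply: eq_bigr => j _ /=.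
rewrite -[in RHS](D1 (q j)) // (lin_sumE (fl _)).
by apply: eq_bigr => l _; rewrite (linZ (fl _)) TC.
Qed.

Lemma dual_bases_coord : biorth e (fun l x => T (q l * x)).
Proof. by have [_ _ _ D3] := D; split=> [i|i j]; [linp | rewrite D3]. Qed.

End DualBases.

Lemma dual_bases_full (k : fieldType) (A : algType k) (T : A -> k) n (e q : 'I_n -> A) :
  slin T -> dual_bases predT T e q -> full_basis e (fun l x => T (q l * x)).
Proof.
by move=> Tl D; split; [exact: (dual_bases_coord Tl D) | case: D => _ D1 _ _ x; rewrite D1].
Qed.

Section RegularTrace.
Variables (k : fieldType) (A : algType k) (n : nat) (e : 'I_n -> A) (c : 'I_n -> A -> k).
Hypothesis ec : full_basis e c.

Definition regular_trace a := tr e c (fun x => a * x).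
Local Notation chi := regular_trace.

Lemma chi_lin : slin chi.
Proof. by move=> d u v; rewrite /regular_trace /tr mulr_sumr -big_split; apply: eq_bigr => i _;
  rewrite mulrDl -scalerAl; apply: ec.1.1. Qed.

Lemma chiC a b : chi (a * b) = chi (b * a).
Proof.
rewrite /regular_trace (@eq_tr _ _ _ e c _ (fun x => a * (b * x))); last by move=> x; rewrite mulrA.
rewrite (@trC _ _ _ _ _ e c e c (fun x => b * x) (fun x => a * x)) //; try linp.
by apply: eq_tr => x; rewrite mulrA.
Qed.

Lemma full_predT : basis_on predT e c.
Proof. by split=> //; [exact: ec.1 | move=> x _; exact: ec.2]. Qed.

Lemma subspace_predT : subspace (predT : {pred A}).
Proof. by []. Qed.

Hypothesis ch : [pchar k] =i pred0.

Lemma chi_idem a : a * a = a -> exists r : nat, [/\ chi a = r%:R, (r <= n)%N & r = 0%N -> a = 0].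
Proof.
move=> aa; have [||r [h1 h2 h3]] := @tr_idem k A _ _ _ (fun x => a * x) ec; first by linp.
  by move=> x; rewrite mulrA aa.
exists r; split=> //; first by rewrite -[n]card_ord.
by move=> /h3 /(_ 1); rewrite mulr1.
Qed.

Lemma chi_idem_eq0 a : a * a = a -> chi a = 0 -> a = 0.
Proof.
case/chi_idem => r [-> _ h] /eqP; have /pcharf0P -> := ch.
by move/eqP.
Qed.

Hypothesis ss : semisimple_algebra A.

(* The radical N of the trace form has a complementary left ideal; the
   component in N of 1 is an idempotent of trace 0. *)
Lemma chi_nondegenerate a : (forall b, chi (a * b) = 0) -> a = 0.
Proof.
move=> ha; pose N : {pred A} := [pred x | `[< forall b, chi (x * b) = 0 >]].
have NP x : reflect (forall b, chi (x * b) = 0) (x \in N) by exact: asboolP.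
have Nideal : left_ideal N.
  split; first split.
  - by apply/NP => b; rewrite mul0r (slin0 chi_lin).
  - by move=> x y /NP hx /NP hy; apply/NP => b; rewrite mulrBl (slinB chi_lin) hx hy subrr.
  - by move=> b x /NP hx; apply/NP => y; rewrite -mulrA chiC -mulrA hx.
have [J [[[J0 JB] Jid] dir dec]] := ss Nideal.
have [nu [j [nuN jJ e1]]] := dec 1.
have nuE : nu = nu * nu + nu * j by rewrite -mulrDr -e1 mulr1.
have nuj : nu * j = 0.
  apply: dir; last exact: Jid.
  have -> : nu * j = nu - nu * nu by apply/eqP; rewrite eq_sym subr_eq addrC -nuE.
  by apply: Nideal.1.2 => //; apply: Nideal.2.
have nu0 : nu = 0.
  apply: chi_idem_eq0; first by rewrite {3}nuE nuj addr0.
  by move/NP: nuN => /(_ 1); rewrite mulr1.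
apply: dir; first exact/NP.
by rewrite -[a]mulr1 e1 nu0 add0r; apply: Jid.
Qed.

Lemma chi_dual_bases : exists q, dual_bases predT chi e q.
Proof.
have [|q [q1 q2 q3 q4]] := exists_dual_basis subspace_predT full_predT chi_lin.
  by move=> a _ h; apply: chi_nondegenerate => b; apply: h.
by exists q; split.
Qed.

End RegularTrace.

Section Nilpotent.
Variables (k : closedFieldType) (A : algType k) (n : nat) (e : 'I_n -> A) (c : 'I_n -> A -> k).
Hypothesis ec : full_basis e c.

Lemma mx_nilpotent_trace m (B : 'M[k]_m) s :
  (forall (v : 'rV_m) (a : k), v *m B = a *: v -> v != 0 -> a ^+ s = 0) -> \tr B = 0.
Proof.
case: m B => [|m] B h; first by rewrite /mxtrace big_ord0.
have [r rE] := closed_field_poly_normal (char_poly B).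
have r0 : {in r, forall x, x = 0}.
  move=> x xr; have : root (char_poly B) x.
    by rewrite rE rootZ ?root_prod_XsubC // lead_coef_eq0 monic_neq0 ?char_poly_monic.
  rewrite -eigenvalue_root_char => /eigenvalueP[v vB v0].
  by have /eqP := h v x vB v0; rewrite expf_eq0 => /andP[_ /eqP].
have sr : size r = m.+1.
  have := size_char_poly B; rewrite rE (monicP (char_poly_monic B)) scale1r size_prod_XsubC.
  by move=> /eqP; rewrite eqSS => /eqP.
have cX : char_poly B = 'X^(m.+1).
  rewrite rE (monicP (char_poly_monic B)) scale1r big_seq.
  rewrite (eq_bigr (fun _ => 'X)); last by move=> x /r0 ->; rewrite polyC0 subr0.
  by rewrite -big_seq big_const_seq count_predT sr iter_mulr_1.
have := @char_poly_trace _ m.+1 B isT.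
rewrite cX coefXn ltn_eqF ?ltnS //= => e0.
by rewrite -[\tr B]opprK -e0 oppr0.
Qed.

Lemma chi_nilpotent a s : a ^+ s = 0 -> regular_trace e c a = 0.
Proof.
move=> as0; rewrite /regular_trace tr_mxf; apply: (@mx_nilpotent_trace _ _ s) => v x vB v0.
pose y := \sum_i v 0 i *: e i.
have yE i : c i y = v 0 i.
  rewrite /y slin_sumE; last exact: ec.1.1.
  rewrite (bigD1 i) //= slinZ ?ec.1.2 ?eqxx ?mulr1; last exact: ec.1.1.
  rewrite big1 ?addr0 // => j /negPf ji; rewrite slinZ ?ec.1.2; last exact: ec.1.1.
  by rewrite eq_sym ji mulr0.
have rvy : rv c y = v by apply/rowP => i; rewrite mxE yE.
have ay : a * y = x *: y.
  apply: (rv_inj ec); rewrite (rv_mxf ec (f := fun z => a * z)); last by linp.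
  rewrite rvy vB -{1}rvy; apply/rowP => i; rewrite !mxE slinZ //; exact: ec.1.1.
have axy t : a ^+ t * y = x ^+ t *: y.
  elim: t => [|t IH]; first by rewrite !expr0 mul1r scale1r.
  by rewrite !exprS -mulrA IH -scalerAr ay scalerA mulrC.
have := axy s; rewrite as0 mul0r => /esym/eqP; rewrite scaler_eq0 => /orP[/eqP //|/eqP y0].
case/negP: v0; apply/eqP; rewrite -rvy y0; apply/rowP => i.
by rewrite !mxE slin0 //; apply: ec.1.1.
Qed.

End Nilpotent.

Lemma tr_basis_indep (k : fieldType) (V : lmodType k) (I J : finType) (e : I -> V) c
    (e' : J -> V) c' f : full_basis e c -> full_basis e' c' -> lin f ->
  tr e c f = tr e' c' f.
Proof. by move=> ec ec' fl; apply: (@trC _ _ _ _ _ e c e' c' (fun x => x) f). Qed.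

Section HornerCentral.
Variables (k : fieldType) (A : algType k).

Lemma horner_alg_comm (a b : A) (p : {poly k}) : a * b = b * a ->
  horner_alg a p * b = b * horner_alg a p.
Proof.
move=> ab; have abX i : a ^+ i * b = b * a ^+ i by apply/commr_sym/commrX/commr_sym.
rewrite -[p]coefK poly_def linear_sum /= mulr_suml mulr_sumr; apply: eq_bigr => i _.
by rewrite linearZ /= rmorphXn /= horner_algX mulr_algl -scalerAl -scalerAr abX.
Qed.
End HornerCentral.

Section Blocks.
Variables (k : closedFieldType) (A : algType k) (n : nat) (e : 'I_n -> A) (c : 'I_n -> A -> k).
Hypothesis ec : full_basis e c.
Hypothesis ch : [pchar k] =i pred0.
Hypothesis ss : semisimple_algebra A.
Local Notation chi := (regular_trace e c).

Definition central (x : A) := forall y, x * y = y * x.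

Lemma centralM x y : central x -> central y -> central (x * y).
Proof. by move=> cx cy w; rewrite -mulrA cy mulrA cx mulrA. Qed.

Definition idempotent_family s (z : 'I_s -> A) :=
  [/\ forall i, central (z i), forall i j, z i * z j = if i == j then z i else 0,
      \sum_i z i = 1 & forall i, z i <> 0].

Lemma family_idem s (z : 'I_s -> A) i : idempotent_family z -> z i * z i = z i.
Proof. by case=> _ zz _ _; rewrite zz eqxx. Qed.

Lemma family_bound s (z : 'I_s -> A) : idempotent_family z -> (s <= n)%N.
Proof.
move=> fz; have [zc zz z1 z0] := fz.
have chi0 i : chi (z i) != 0.
  by apply/eqP => h; apply: (z0 i); apply: (chi_idem_eq0 ec ch) h; apply: family_idem.
have cl := chi_lin ec.
apply: (@biorth_bound k A s n z (fun i x => (chi (z i))^-1 * chi (z i * x)) e).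
  split=> [i|i j]; first by linp.
  by rewrite zz; case: eqP => _; rewrite ?mulVf // (slin0 cl) mulr0.
by move=> i; exists (fun j => c j (z i)); apply: ec.2.
Qed.

Lemma maximal_family : (1 : A) <> 0 -> exists s (z : 'I_s -> A), idempotent_family z /\
  forall z' : 'I_s.+1 -> A, ~ idempotent_family z'.
Proof.
move=> A1; apply: contrapT => nex.
have ext s : exists z : 'I_s.+1 -> A, idempotent_family z.
  elim: s => [|s [z fz]].
    exists (fun=> 1); split=> //; first by move=> i y; rewrite mul1r mulr1.
      by move=> i j; rewrite !ord1 eqxx mulr1.
    by rewrite big_ord1.
  by apply: contrapT => nz; apply: nex; exists s.+1, z; split=> // z' fz'; apply: nz; exists z'.
have [z /family_bound] := ext n; by rewrite ltnn.
Qed.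

Section Maximal.
Variables (s : nat) (z : 'I_s -> A).
Hypothesis fz : idempotent_family z.
Hypothesis zmax : forall z' : 'I_s.+1 -> A, ~ idempotent_family z'.

Lemma family_primitive i f : central f -> f * f = f -> f * z i = f -> f = 0 \/ f = z i.
Proof.
move=> fc ff fi; have [zc zz z1 z0] := fz.
have [f0|f0] := pselect (f = 0); first by left.
have [fzi|fzi] := pselect (f = z i); first by right.
have fz' j : f * z j = if j == i then f else 0.
  by rewrite -{1}fi -mulrA zz eq_sym; case: eqP => _; rewrite ?fi ?mulr0.
exfalso; apply: (zmax (z' := fun l => if unlift ord0 l is Some j
    then (if j == i then z i - f else z j) else f)); split.
- move=> l; case: unliftP => [j _|_] //; case: eqP => _ // y.
  by rewrite mulrBl mulrBr zc fc.
- move=> l1 l2; case: unliftP => [j1 ->|->]; case: unliftP => [j2 ->|->] /=.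
  + rewrite (inj_eq lift_inj); case: (eqVneq j1 i) => [e1|n1]; case: (eqVneq j2 i) => [e2|n2]; rewrite ?e1 ?e2.
    * by rewrite eqxx mulrBl !mulrBr ff fi -fc fi (family_idem _ fz) subrr subr0.
    * by rewrite eq_sym (negPf n2) mulrBl zz eq_sym (negPf n2) fz' (negPf n2) subrr.
    * by rewrite (negPf n1) mulrBr zz (negPf n1) -fc fz' (negPf n1) subrr.
    * by rewrite zz.
  + case: eqP => [_|/eqP n1].
      by rewrite mulrBl ff -fc fi subrr.
    by rewrite -fc fz' (negPf n1).
  + case: eqP => [_|/eqP n1].
      by rewrite mulrBr ff fi subrr.
    by rewrite fz' (negPf n1).
  + by rewrite ff.
- rewrite big_ord_recl unlift_none; under eq_bigr do rewrite liftK.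
  rewrite (bigD1 i) //= eqxx -z1 [RHS](bigD1 i) //= addrA [f + _]addrC subrK.
  by congr (_ + _); apply: eq_bigr => j /negPf ->.
move=> l; case: unliftP => [j _|_] //; case: eqP => // _ /eqP.
by rewrite subr_eq0 => /eqP/esym.
Qed.

Lemma block_eigenvector i a : exists x y, [/\ y <> 0, z i * y = y & a * y = x *: y].
Proof.
have [zc zz z1 z0] := fz.
have [p p0 pa] := annihilating_poly ec a.
have [r rE] := closed_field_poly_normal p.
have : horner_alg a (\prod_(x <- r) ('X - x%:P)) * z i = 0.
  apply/eqP; have := congr1 (fun u => u * z i) pa; rewrite rE linearZ /= mul0r mulr_algl -scalerAl.
  by move/eqP; rewrite scaler_eq0 lead_coef_eq0 (negPf p0).
elim: r {rE} => [|x r IH]; first by rewrite big_nil rmorph1 mul1r => /z0.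
rewrite big_cons rmorphM rmorphB /= horner_algX horner_algC -mulrA.
have [h|h] := pselect (horner_alg a (\prod_(x <- r) ('X - x%:P)) * z i = 0).
  by move=> _; apply: IH.
move=> e0; exists x, (horner_alg a (\prod_(x <- r) ('X - x%:P)) * z i); split=> //.
  by rewrite zc -mulrA family_idem.
by apply/eqP; rewrite -subr_eq0 -mulr_algl -mulrBl e0.
Qed.

(* Fitting's idempotent of (a - x) z_i is central, so it is 0 or z_i; it is not z_i as
   a - x kills a nonzero element of the block. *)
Lemma central_scalar i a : central a -> exists x, a * z i = x *: z i.
Proof.
move=> ac; have [zc zz z1 z0] := fz.
have [x [y [y0 zy ay]]] := block_eigenvector i a.
pose b := (a - x%:A) * z i.
have bc : central b.
  apply: centralM; last exact: zc.
  by move=> w; rewrite mulrBl mulrBr ac mulr_algl mulr_algr.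
have bz : b * z i = b by rewrite /b -mulrA family_idem.
have by0 : b * y = 0 by rewrite /b -mulrA zy mulrBl ay mulr_algl subrr.
have [t [u [ff bf]]] := fitting_idempotent ec b.
set f := horner_alg b _ in ff bf.
have fE : f = b * horner_alg b (u * 'X^t).
  rewrite /f exprSr mulrA rmorphM /= horner_algX.
  by rewrite horner_alg_comm.
have fc : central f by move=> w; apply: horner_alg_comm.
have fzi : f * z i = f by rewrite -zc fE mulrA zc bz.
have [f0|fi] := family_primitive fc ff fzi; last first.
  case: y0; rewrite -zy -fi fE -(@horner_alg_comm _ _ b b) //.
  by rewrite -mulrA by0 mulr0.
have b0 : b = 0.
  apply: (chi_nondegenerate ec ch ss) => w; apply: (chi_nilpotent ec (s := t.+1)).
  have bt : b ^+ t.+1 = 0 by rewrite bf f0 mulr0.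
  by rewrite exprMn_comm; [rewrite bt mul0r | apply: bc].
by exists x; apply/eqP; rewrite -subr_eq0 -mulr_algl -mulrBl -/b b0.
Qed.

Definition block_dim i : nat := \rank (mxf e c (fun x => z i * x)).

Lemma block_dimE i : chi (z i) = (block_dim i)%:R.
Proof.
rewrite /block_dim -mx_idem_trace -?tr_mxf // -(mxf_comp ec); try by linp.
by apply/matrixP => j l; rewrite !mxE mulrA family_idem.
Qed.

Lemma block_dim_gt0 i : (0 < block_dim i)%N.
Proof.
rewrite lt0n; apply/eqP => d0; case: fz => _ _ _ /(_ i); apply.
by apply: (chi_idem_eq0 ec ch); rewrite ?block_dimE ?d0 //; apply: family_idem.
Qed.

Lemma block_dim_neq0 i : (block_dim i)%:R != 0 :> k.
Proof. by have /pcharf0P -> := ch; rewrite -lt0n block_dim_gt0. Qed.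

(* x |-> \sum_l q_l x e_l maps into the center, hence acts on each block as a scalar. *)
Lemma tr_mul_mul a b : tr e c (fun x => a * x * b) =
  \sum_i chi (a * z i) * chi (b * z i) / (block_dim i)%:R.
Proof.
have cl := chi_lin ec; have cC := chiC ec.
have [q D] := chi_dual_bases ec ch ss; have [_ D1 D2 _] := D.
have fb := dual_bases_full cl D.
have trE f : lin f -> tr e c f = \sum_l chi (q l * f (e l)).
  by move=> fl; apply: (tr_basis_indep ec fb).
pose pi x := \sum_l e l * x * q l.
have piE x : pi x = \sum_l q l * x * e l.
  rewrite /pi; apply: (dual_bases_sym D (f := fun u v => u * x * v)); [linp | by move=> ? ? _ _].
have piC x : central (pi x).
  move=> y; rewrite /pi mulr_suml mulr_sumr.
  have := dual_bases_casimir D (f := fun u v => u * x * v) (x := y).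
  move=> h; under eq_bigr do rewrite -mulrA.
  rewrite -h //; last by linp.
  by apply: eq_bigr => l _; rewrite !mulrA.
have qe : \sum_l e l * q l = 1.
  apply/eqP; rewrite -subr_eq0; apply/eqP; apply: (chi_nondegenerate ec ch ss) => x.
  rewrite mulrBl mul1r (slinB cl) mulr_suml (slin_sumE cl) [X in _ - X]trE; last by linp.
  apply/eqP; rewrite subr_eq0; apply/eqP; apply: eq_bigr => l _.
  by rewrite -mulrA cC mulrA cC mulrA.
have [zc _ z1 _] := fz.
have pis i : pi a * z i = (chi (a * z i) / (block_dim i)%:R) *: z i.
  have [x xE] := central_scalar i (piC a); rewrite xE; congr (_ *: _).
  apply: (mulIf (block_dim_neq0 i)); rewrite mulfVK ?block_dim_neq0 //.
  rewrite -block_dimE -slinZ // -xE piE mulr_suml (slin_sumE cl).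
  rewrite -[in RHS](mulr1 (a * z i)) -qe mulr_sumr (slin_sumE cl).
  by apply: eq_bigr => l _; rewrite -!mulrA [LHS]cC -!mulrA; rewrite !zc -!mulrA.
rewrite trE; last by linp.
rewrite (_ : \sum_l _ = chi (pi a * b)); last first.
  by rewrite piE mulr_suml (slin_sumE cl); apply: eq_bigr => l _; rewrite !mulrA.
rewrite -[pi a]mulr1 -z1 mulr_sumr mulr_suml (slin_sumE cl); apply: eq_bigr => i _.
by rewrite pis -scalerAl slinZ // zc mulrAC.
Qed.

End Maximal.
End Blocks.

Section FiniteOrder.
Variables (k : closedFieldType).
Hypothesis ch : [pchar k] =i pred0.

Lemma exists_prim_root M : (0 < M)%N -> exists z : k, M.-primitive_root z.
Proof.
move=> M0; have [r rE] := closed_field_poly_normal ('X^M - 1 : {poly k}).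
rewrite (monicP (monicXnsubC _ M0)) scale1r in rE.
have rn1 : all M.-unity_root r by apply/allP => z; rewrite -root_prod_XsubC -rE.
have sr : (M < (size r).+1)%N by rewrite -(size_prod_XsubC r id) -rE size_XnsubC.
have [|z _ zP] := hasP (has_prim_root M0 rn1 _ sr); last by exists z.
rewrite -separable_prod_XsubC -rE separable_Xn_sub_1 //.
by have /pcharf0P -> := ch; rewrite -lt0n.
Qed.

Lemma exists_root_of M (x : k) : (0 < M)%N -> exists y, y ^+ M = x.
Proof.
move=> M0; have [|y] := closed_rootP ('X^M - x%:P) _; first by rewrite size_XnsubC // eqSS -lt0n.
by rewrite rootE !hornerE subr_eq0 => /eqP; exists y.
Qed.

Section Spectral.
Variables (A : algType k) (M : nat) (v : A) (z : k).
Hypotheses (M0 : (0 < M)%N) (vM : v ^+ M = 1) (zM : M.-primitive_root z).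

Definition spectral (j : nat) : A := M%:R^-1 *: \sum_(l < M) (z ^- j) ^+ l *: v ^+ l.

Let M1 : M%:R != 0 :> k.
Proof. by have /pcharf0P -> := ch; rewrite -lt0n. Qed.

Let z0 : z != 0.
Proof. by apply: contraTneq M0 => e; have := prim_expr_order zM; rewrite e expr0n; case: M => // m /esym/eqP; rewrite oner_eq0. Qed.

Lemma spectral_eigen j : v * spectral j = z ^+ j *: spectral j.
Proof.
rewrite /spectral -scalerAr scalerA mulrC -scalerA; congr (_ *: _).
rewrite mulr_sumr scaler_sumr.
have E l : v * ((z ^- j) ^+ l *: v ^+ l) = z ^+ j *: ((z ^- j) ^+ l.+1 *: v ^+ l.+1).
  by rewrite -scalerAr -exprS scalerA [(z ^- j) ^+ l.+1]exprS mulrA mulfV ?mul1r // expf_neq0.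
under eq_bigr do rewrite E.
rewrite -!scaler_sumr; congr (_ *: _).
case: M M0 vM zM => // m _ vm zm.
rewrite big_ord_recr [RHS]big_ord_recl /= addrC; congr (_ + _).
by rewrite vm !expr0 -exprVn -exprM mulnC exprM exprVn (prim_expr_order zm) invr1 expr1n.
Qed.

Lemma spectral_eigenX j l : v ^+ l * spectral j = (z ^+ j) ^+ l *: spectral j.
Proof.
elim: l => [|l IH]; first by rewrite !expr0 mul1r scale1r.
by rewrite !exprS -mulrA IH -scalerAr spectral_eigen scalerA mulrC.
Qed.

Lemma spectral_idem j : spectral j * spectral j = spectral j.
Proof.
rewrite {1}/spectral -scalerAl mulr_suml.
under eq_bigr do rewrite -scalerAl spectral_eigenX scalerA -exprMn mulVf ?expf_neq0 // expr1n scale1r.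
by rewrite sumr_const card_ord -scaler_nat scalerA mulVf ?scale1r.
Qed.

Lemma sum_spectral : \sum_(j < M) spectral j = 1.
Proof.
rewrite -scaler_sumr exchange_big /=; under eq_bigr do rewrite -scaler_suml.
rewrite (bigD1 (Ordinal M0)) //= [X in _ + X]big1 ?addr0.
  rewrite (eq_bigr (fun _ => 1)) => [|? _]; last by rewrite expr0.
  by rewrite sumr_const card_ord ?expr0 scalerA mulVf ?scale1r.
move=> l l0; rewrite (_ : \sum_j _ = 0) ?scale0r //.
under eq_bigr do rewrite -exprVn -exprM mulnC exprM.
set y := _ ^+ l; have yM : y ^+ M = 1.
  by rewrite /y -exprM mulnC exprM exprVn (prim_expr_order zM) invr1 expr1n.
have y1 : y != 1.
  rewrite /y exprVn invr_eq1 -(prim_order_dvd zM) gtnNdvd //.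
  by rewrite lt0n.
apply: (mulfI (_ : y - 1 != 0)); first by rewrite subr_eq0.
by rewrite mulr0 -subrX1 yM subrr.
Qed.

Lemma spectral_comm j a : v * a = a * v -> spectral j * a = a * spectral j.
Proof.
move=> va; rewrite /spectral -scalerAl -scalerAr mulr_suml mulr_sumr; congr (_ *: _).
by apply: eq_bigr => l _; rewrite -scalerAl -scalerAr commrX.
Qed.

End Spectral.
End FiniteOrder.

Section Conjugation.
Variables (k : closedFieldType) (A : algType k) (n : nat) (e : 'I_n -> A) (c : 'I_n -> A -> k).
Hypothesis ec : full_basis e c.
Hypothesis ch : [pchar k] =i pred0.
Hypothesis ss : semisimple_algebra A.
Local Notation chi := (regular_trace e c).

(* Rescaling w on each block to v with v^M = 1 turns the trace into
   \sum_i |chi (v z_i)|^2 / dim_i, the block of the trivial module contributing 1. *)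
Lemma tr_conj_neq0 (u w L : A) (eps : A -> k) M : (0 < M)%N ->
  u * w = 1 -> w * u = 1 -> central (w ^+ M) ->
  slin eps -> eps 1 = 1 -> {morph eps : x y / x * y} -> eps L = 1 ->
  (forall x, x * L = eps x *: L) -> (forall x, L * x = eps x *: L) ->
  tr e c (fun x => u * x * w) <> 0.
Proof.
move=> M0 uw wu wMc epsl eps1 epsM epsL Ll Lr.
have A1 : (1 : A) <> 0.
  by move=> e1; have /eqP := eps1; rewrite e1 (slin0 epsl) eq_sym oner_eq0.
have [s [z [fz zmax]]] := maximal_family ec ch A1.
have [zc zz z1 z0] := fz.
pose D := block_dim e c z.
have [x xE] := choice (fun i => central_scalar ec ch ss fz zmax i wMc).
have x0 i : x i != 0.
  apply/eqP => xi; apply: (z0 i); have := xE i; rewrite xi scale0r => h.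
  have uM : u ^+ M * w ^+ M = 1.
    by rewrite -exprMn_comm ?uw ?expr1n // /GRing.comm uw wu.
  by rewrite -[z i]mul1r -uM -mulrA h mulr0.
have [r rE] := choice (fun i => exists_root_of (x i) M0).
have r0 i : r i != 0.
  by apply: contra_neq (x0 i) => ri; rewrite -rE ri expr0n gtn_eqF.
pose v := \sum_i (r i)^-1 *: (w * z i); pose v' := \sum_i r i *: (u * z i).
have vz i : v * z i = (r i)^-1 *: (w * z i).
  rewrite /v mulr_suml (bigD1 i) //= -scalerAl -mulrA zz eqxx big1 ?addr0 // => j /negPf ji.
  by rewrite -scalerAl -mulrA zz ji mulr0 scaler0.
have v'z i : v' * z i = r i *: (u * z i).
  rewrite /v' mulr_suml (bigD1 i) //= -scalerAl -mulrA zz eqxx big1 ?addr0 // => j /negPf ji.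
  by rewrite -scalerAl -mulrA zz ji mulr0 scaler0.
have vXz i l : v ^+ l * z i = (r i)^-1 ^+ l *: (w ^+ l * z i).
  elim: l => [|l IH]; first by rewrite !expr0 scale1r.
  rewrite !exprSr -mulrA vz -scalerAr -zc mulrA -zc mulrA zc IH.
  by rewrite -scalerAl scalerA mulrC -mulrA zc mulrA.
have vM : v ^+ M = 1.
  rewrite -[v ^+ M]mulr1 -z1 mulr_sumr; apply: eq_bigr => i _.
  by rewrite vXz xE scalerA exprVn rE mulVf ?scale1r.
have vv' : v' * v = 1.
  rewrite -[v]mulr1 -z1 !mulr_sumr; apply: eq_bigr => i _.
  rewrite vz -scalerAr -zc mulrA -[v' * _]/(v' * z i) v'z -scalerAl scalerA mulVf // scale1r.
  by rewrite -mulrA zc mulrA uw mul1r.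
have [t tM] := exists_prim_root ch M0.
pose p := spectral M v t.
have pz_comm i j : p j * z i = z i * p j by apply: spectral_comm; rewrite zc.
have pz_idem i j : p j * z i * (p j * z i) = p j * z i.
  by rewrite -mulrA [z i * _]mulrA -pz_comm -mulrA family_idem // mulrA spectral_idem.
have chiN i j : exists m : nat, chi (p j * z i) = m%:R.
  by have [m [? _ _]] := chi_idem ec (pz_idem i j); exists m.
have ex2 i : exists f : nat -> nat, forall j, chi (p j * z i) = (f j)%:R.
  by have [f fP] := choice (chiN i); exists f.
have [m mE] := choice ex2.
have cl := chi_lin ec.
have t0 : t != 0.
  apply: contraTneq M0 => e0; have := prim_expr_order tM.
  by rewrite e0 expr0n; case: (M) => // M' /esym/eqP; rewrite oner_eq0.
have chiv i : chi (v * z i) = \sum_(j < M) (m i j)%:R * t ^+ j.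
  rewrite -[v]mulr1 -(sum_spectral ch v M0 tM) mulr_sumr mulr_suml (slin_sumE cl).
  apply: eq_bigr => j _; rewrite spectral_eigen // -scalerAl slinZ // mE.
  by rewrite mulrC.
have chiv' i : chi (v' * z i) = \sum_(j < M) (m i j)%:R * t ^+ (M - j).
  rewrite -[v']mulr1 -(sum_spectral ch v M0 tM) mulr_sumr mulr_suml (slin_sumE cl).
  apply: eq_bigr => j _.
  have -> : v' * spectral M v t j = t ^+ (M - j) *: spectral M v t j.
    rewrite -[spectral M v t j in LHS](scale1r) -(prim_expr_order tM).
    rewrite -{1}(subnK (ltnW (ltn_ord j))) exprD -scalerA -spectral_eigen // -scalerAr.
    by rewrite mulrA vv' mul1r.
  by rewrite -scalerAl slinZ // mE mulrC.
have trE : tr e c (fun y => u * y * w) = \sum_i chi (v * z i) * chi (v' * z i) / (D i)%:R.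
  rewrite (tr_mul_mul ec ch ss fz zmax); apply: eq_bigr => i _.
  by rewrite vz v'z !slinZ // mulrACA mulVf // mul1r [chi _ * chi _]mulrC.
have [i0 i0L] : exists i, L * z i <> 0.
  apply: contrapT => h; have := epsL; have -> : L = 0.
    rewrite -[L]mulr1 -z1 mulr_sumr big1 // => i _.
    by apply: contrapT => hi; apply: h; exists i.
  by rewrite (slin0 epsl) => /esym/eqP; rewrite oner_eq0.
have LL : L * L = L by rewrite Ll epsL scale1r.
have epszi : eps (z i0) = 1.
  have := epsM (z i0) (z i0); rewrite family_idem // -[LHS]mul1r => /mulIf -> //.
  by apply/eqP => h; apply: i0L; rewrite Lr h scale0r.
have zL : z i0 = L.
  have Lc : central L by move=> y; rewrite Ll Lr.
  have [y yE] := central_scalar ec ch ss fz zmax i0 Lc.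
  move: yE; rewrite Lr epszi scale1r => yE.
  have : y = 1 by have := epsL; rewrite yE slinZ // epszi mulr1.
  by move=> y1; rewrite yE y1 scale1r.
have regular_trace_integral : chi L = 1.
  rewrite /regular_trace /tr; under eq_bigr do rewrite Lr (slinZ (ec.1.1 _)).
  rewrite -[RHS]epsL [in RHS](ec.2 L) (slin_sumE epsl); apply: eq_bigr => l _.
  by rewrite slinZ // mulrC.
have mi0 j : (m i0 j)%:R = eps (p j) by rewrite -mE zL Ll slinZ // regular_trace_integral mulr1.
have /pcharf0P natk0 := ch.
have sum_m : (\sum_(j < M) m i0 j = 1)%N.
  have : (\sum_(j < M) m i0 j)%:R = 1%:R :> k.
    rewrite natr_sum; under eq_bigr do rewrite mi0.
    by rewrite -(slin_sumE epsl) sum_spectral.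
  move/eqP; rewrite -subr_eq0; case: (\sum_(j < M) m i0 j)%N => [|a].
    by rewrite sub0r oppr_eq0 oner_eq0.
  by rewrite -addn1 natrD addrK natk0 => /eqP ->.
have [j0 mj0] : exists j0 : 'I_M, (0 < m i0 j0)%N.
  apply: contrapT => h; have := sum_m; rewrite big1 // => j _.
  by case E: (m i0 j) => [//|a]; case: h; exists j; rewrite E.
have mi0E (j : 'I_M) : m i0 j = (j == j0).
  have := sum_m; rewrite (bigD1 j0) //=; case E: (m i0 j0) mj0 => [//|[|a]] // _.
  move=> /eqP; rewrite -[X in _ == X]addn0 eqn_add2l.
  rewrite sum_nat_eq0 => /forallP h; case: eqVneq => [->//|jj].
  by have := h j; rewrite jj => /eqP.
pose wt i := (\prod_(l | l != i) D l)%N.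
have wt0 i : (0 < wt i)%N by apply: prodn_cond_gt0 => l _; apply: block_dim_gt0.
move=> tr0; have := twisted_sum_neq0_pchar0 (m := fun i j => m i j) wt0 mi0E ch (prim_expr_order tM).
case/negP; apply/eqP; rewrite /twisted_sum.
transitivity ((\prod_l D l)%:R * tr e c (fun y => u * y * w)); last by rewrite tr0 mulr0.
rewrite trE mulr_sumr; apply: eq_bigr => i _.
rewrite (bigD1 i) //= natrM -/(wt i) -chiv -chiv' [(D i)%:R * _]mulrC -!mulrA.
congr (_ * _); rewrite [RHS]mulrC -!mulrA mulVf ?mulr1 //.
exact: block_dim_neq0.
Qed.
End Conjugation.

(** * Integrals *)

Section Integral.
Variables (k : fieldType) (H : hopfAlgType k).
Local Notation S := (@antipode k H).
Local Notation eps := (@counit k H).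

Definition two_sided_integral (L : H) :=
  (forall x, x * L = eps x *: L) /\ (forall x, L * x = eps x *: L).

Lemma left_idealZ (A : algType k) (J : {pred A}) c x : left_ideal J -> x \in J -> c *: x \in J.
Proof. by move=> [_ h] xJ; rewrite -mulr_algl; apply: h. Qed.

Lemma exists_integral : semisimple_algebra H -> exists2 L : H, two_sided_integral L & eps L = 1.
Proof.
move=> ss; have el := @counit_lin _ H.
have Iideal : left_ideal [pred x : H | eps x == 0].
  split; first split; rewrite ?inE ?(slin0 el) //.
    by move=> x y; rewrite !inE (slinB el) => /eqP -> /eqP ->; rewrite subrr.
  by move=> a x; rewrite !inE counitM => /eqP ->; rewrite mulr0.
have [J [Jid dir dec]] := ss _ Iideal.
have [y [L [yI LJ e1]]] := dec 1.
have epsL : eps L = 1.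
  by move: yI; rewrite inE -(counit1 (s := H)) e1 (slinD el) => /eqP ->; rewrite add0r.
have Ll x : x * L = eps x *: L.
  apply/eqP; rewrite -subr_eq0; apply/eqP; apply: dir.
    by rewrite inE (slinB el) counitM (slinZ el) subrr.
  by apply: Jid.1.2; [apply: Jid.2 | apply: left_idealZ].
exists L => //; split=> // h; pose v := L * h - eps h *: L.
have vl x : x * v = eps x *: v.
  by rewrite /v mulrBr mulrA -scalerAr Ll -scalerAl scalerBr !scalerA mulrC.
have epsv : eps v = 0 by rewrite (slinB el) counitM (slinZ el) epsL mul1r mulr1 subrr.
have vP x : reflect (exists c, x = c *: v) (x \in [pred x : H | `[< exists c, x = c *: v >]]).
  exact: asboolP.
have [|J' [J'id dir' dec']] := ss [pred x : H | `[< exists c, x = c *: v >]].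
  split; first split.
  - by apply/vP; exists 0; rewrite scale0r.
  - by move=> _ _ /vP[a ->] /vP[b ->]; apply/vP; exists (a - b); rewrite scalerBl.
  - by move=> a _ /vP[b ->]; apply/vP; exists (b * eps a); rewrite -scalerAr vl scalerA.
have [_ [j [/vP[c ->] jJ e1']]] := dec' 1.
have vv : v = v * j.
  by rewrite -[LHS]mulr1 e1' mulrDr -scalerAr vl epsv scale0r scaler0 add0r.
apply/eqP; rewrite -subr_eq0; apply/eqP; apply: dir'.
  by apply/vP; exists 1; rewrite scale1r.
by rewrite -/v vv; apply: J'id.2.
Qed.

Section Antipode.
Variable L : H.
Hypotheses (Ll : forall x, x * L = eps x *: L) (epsL : eps L = 1).

Lemma integral_casimir (W : lmodType k) (f : H -> H -> W) h : bil f ->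
  sw (fun a b => f (h * a) (S b)) L = sw (fun a b => f a (S b * h)) L.
Proof.
move=> hf; apply: (@left_integral_casimir k H predT) => //.
by move=> x _; exists (comul x).
Qed.

Lemma integral_mul_antipode : sw (fun a b => a * S b) L = 1.
Proof. by rewrite (@sw_antr k H _ (fun z => z)) ?epsL ?scale1r //; linp. Qed.

Lemma finite_dimensional : exists n (e : 'I_n -> H) c, full_basis e c.
Proof.
pose N := size (comul L); pose p (i : 'I_N) := nth (0, 0) (comul L) i.
have swE (W : lmodType k) (f : H -> H -> W) : sw f L = \sum_i f (p i).1 (p i).2.
  by rewrite /sw (big_nth (0, 0)) big_mkord.
have [n [f [c [[cl _] cf]]]] := exists_basis_span (fun i => S (p i).2).
pose s (l : 'I_#|{: 'I_n * 'I_N}|) : H :=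
  let ij := enum_val l in (p ij.2).1 * f ij.1.
have [|m [e [d [bi _ ex]]]] := @exists_basis_on k H predT _ s (subspace_predT H); last first.
  by exists m, e, d; split=> // x; apply: ex.
move=> h _; pose M (ij : 'I_n * 'I_N) := c ij.1 (S (p ij.2).2 * h).
exists (fun l => M (enum_val l)).
rewrite -(reindex _ (onW_bij _ (@enum_val_bij _)) (P := predT)
  (F := fun ij : 'I_n * 'I_N => M ij *: ((p ij.2).1 * f ij.1))) /=.
rewrite -(pair_bigA _ (fun i j => M (i, j) *: ((p j).1 * f i))) /=.
transitivity (\sum_i sw (fun a b => c i (S b) *: (h * a * f i)) L).
  rewrite -[LHS]mulr1 -integral_mul_antipode swE mulr_sumr.
  under [RHS]eq_bigr do rewrite swE.
  rewrite exchange_big; apply: eq_bigr => j _ /=.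
  rewrite {1}cf !mulr_sumr; apply: eq_bigr => i _.
  by rewrite -!scalerAr mulrA.
apply: eq_bigr => i _.
rewrite (@integral_casimir _ (fun a b => c i b *: (a * f i)) h); last by linp.
by rewrite swE.
Qed.

Hypothesis Lr : forall x, L * x = eps x *: L.

Lemma antipode_inj : injective S.
Proof.
have [n [e [c [[cl _] ex]]]] := finite_dimensional.
suff S0 h : S h = 0 -> h = 0.
  move=> x y xy; apply/eqP; rewrite -subr_eq0; apply/eqP; apply: S0.
  by rewrite (linB (@antipode_lin _ H)) xy subrr.
move=> Sh; have ayh y j : sw (fun a b => c j b *: (a * (y * h))) L = 0.
  rewrite (@right_integral_casimir _ _ _ (fun a b => c j b *: a)) //; last by linp.
  under eq_sw do rewrite antipodeM Sh mul0r mulr0 slin0 // scale0r.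
  by rewrite /sw big1.
rewrite -[h]mul1r -integral_mul_antipode /sw mulr_suml.
rewrite -/(sw (fun a b => a * S b * h) L).
transitivity (\sum_j sw (fun a b => c j b *: (a * (S (e j) * h))) L).
  rewrite exchange_big; apply: eq_bigr => p _ /=.
  rewrite {1}[p.2]ex (lin_sumE (@antipode_lin _ H)) mulr_sumr mulr_suml; apply: eq_bigr => j _.
  by rewrite (linZ (@antipode_lin _ H)) -scalerAr -scalerAl mulrA.
by rewrite big1.
Qed.

End Antipode.
End Integral.

Section DualIntegral.
Variables (k : fieldType) (H : hopfAlgType k) (n : nat) (e : 'I_n -> H) (c : 'I_n -> H -> k).
Hypothesis ec : full_basis e c.
Variable L : H.
Hypotheses (Lint : two_sided_integral L) (epsL : counit L = 1).
Variable T : H -> H.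
Hypotheses (Tlin : lin T) (SK : cancel (@antipode k H) T) (TK : cancel T (@antipode k H)).
Local Notation S := (@antipode k H).
Local Notation eps := (@counit k H).

Let cl i : slin (c i). Proof. exact: ec.1.1. Qed.
Let Sl := @antipode_lin k H.
Let el := @counit_lin k H.

Lemma basis_expand (W : lmodType k) (f : H -> W) x : lin f -> f x = \sum_i c i x *: f (e i).
Proof. by move=> hf; rewrite {1}[x]ec.2 lin_sumE //; apply: eq_bigr => i _; rewrite linZ. Qed.

Lemma sum_sw (W : lmodType k) (I : finType) (F : I -> H -> H -> W) x :
  \sum_i sw (F i) x = sw (fun a b => \sum_i F i a b) x.
Proof. by rewrite /sw exchange_big. Qed.

Definition antipode_trace h := tr e c (fun x => S (S (x * h))).
Local Notation lam := antipode_trace.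

Lemma lam_lin : slin lam.
Proof. by rewrite /antipode_trace /tr; linp. Qed.
Let ll := lam_lin.

Lemma lamL : lam L = 1.
Proof.
rewrite /antipode_trace /tr; under eq_bigr do rewrite Lint.1 !linZ // slinZ //.
have <- : eps (S (S L)) = 1 by rewrite !counit_antipode.
by rewrite [in RHS](ec.2 (S (S L))) slin_sumE //; apply: eq_bigr => i _; rewrite slinZ // mulrC.
Qed.

Lemma sw_inv_antipode (W : lmodType k) (f : H -> W) x : lin f ->
  sw (fun a b => f (T b * a)) x = eps x *: f 1.
Proof.
move=> hf; have T1 : T 1 = 1 by rewrite -[X in T X]antipode1 SK.
rewrite -{1}T1 -(@sw_antl k H _ (fun y => f (T y))); last by linp.
by apply: eq_sw => a b; congr f; apply: (can_inj SK); rewrite antipodeM !TK.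
Qed.

Lemma sw_absorb (W : lmodType k) (f : H -> H -> W) x h : bil f ->
  sw (fun a b => f (x * a) b) h = sw (fun p q => sw (fun u v => f u (T q * v)) (p * h)) x.
Proof.
move=> hf.
under [RHS]eq_sw => p q.
  rewrite swM; last by linp.
  under eq_sw => p1 p2 do under eq_sw => a b do rewrite mulrA.
  over.
rewrite swA; [|linp|linp|linp].
under [RHS]eq_sw => p1 q.
  rewrite (@sw_inv_antipode _ (fun z => sw (fun a b => f (p1 * a) (z * b)) h)); last by linp.
  over.
rewrite (@sw_counitr k H _ (fun p1 => sw (fun a b => f (p1 * a) (1 * b)) h)); last by linp.
by apply: eq_sw => a b; rewrite mul1r.
Qed.

Lemma comul_antipode2 (W : lmodType k) (f : H -> H -> W) x : bil f ->
  sw f (S (S x)) = sw (fun a b => f (S (S a)) (S (S b))) x.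
Proof. by move=> hf; rewrite comul_antipode // comul_antipode //; linp. Qed.

Lemma lam_integral h : sw (fun a b => lam a *: b) h = lam h *: 1.
Proof.
transitivity (\sum_i sw (fun a b => c i (S (S (e i * a))) *: b) h).
  rewrite /sw exchange_big; apply: eq_bigr => p _ /=.
  by rewrite /antipode_trace /tr scaler_suml.
under eq_bigr => i _.
  rewrite (@sw_absorb _ (fun a b => c i (S (S a)) *: b)); last by linp.
  over.
transitivity (\sum_i \sum_j sw (fun p q => sw (fun u v =>
    c j (p * h) *: (c i (S (S u)) *: (T q * v))) (e j)) (e i)).
  apply: eq_bigr => i _; rewrite sum_sw; apply: eq_sw => p q.
  rewrite [LHS]basis_expand; last by linp.
  by apply: eq_bigr => j _; rewrite swZ.
rewrite exchange_big.
transitivity (\sum_j sw (fun u v => sw (fun p q => c j (p * h) *: (T q * v)) (S (S u))) (e j)).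
  apply: eq_bigr => j _.
  under eq_bigr do rewrite sw_swap.
  rewrite sum_sw; apply: eq_sw => u v.
  rewrite [RHS]basis_expand; last by linp.
  apply: eq_bigr => i _; rewrite -swZ; apply: eq_sw => a b.
  by rewrite !scalerA mulrC.
rewrite /antipode_trace (@trC _ _ _ _ _ e c e c (fun x => x * h) (fun x => S (S x))) //; try linp.
rewrite /tr scaler_suml; apply: eq_bigr => j _.
under eq_sw => u v.
  rewrite comul_antipode2; last by linp.
  under eq_sw => a b do rewrite SK.
  over.
rewrite swA; [|linp|linp|linp].
under eq_sw => a w.
  rewrite (@sw_antl k H _ (fun z => c j (S (S a) * h) *: z)); last by linp.
  over.
by rewrite (@sw_counitr k H _ (fun a => c j (S (S a) * h) *: 1)) //; linp.
Qed.

Lemma lam_casimirl x : sw (fun a b => lam (x * a) *: S b) L = x.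
Proof.
rewrite (@integral_casimir k H L Lint.1 _ (fun a b => lam a *: b)); last by linp.
rewrite (_ : sw _ L = S (sw (fun a b => lam a *: b) L) * x).
  by rewrite lam_integral lamL scale1r antipode1 mul1r.
rewrite (@sw_out _ _ _ _ (fun z => S z * x)); last by linp.
by apply: eq_sw => a b; rewrite linZ // scalerAl.
Qed.

Lemma lam_casimirr x : sw (fun a b => lam (a * x) *: S b) L = S (S x).
Proof.
rewrite (@right_integral_casimir k H _ (fun a b => lam a *: S b)) //; [|by linp|exact: Lint.2].
rewrite (_ : sw _ L = S (sw (fun a b => lam a *: b) L * S x)).
  by rewrite lam_integral lamL scale1r mul1r.
rewrite (@sw_out _ _ _ _ (fun z => S (z * S x))); last by linp.
by apply: eq_sw => a b; rewrite -linZ // scalerAl.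
Qed.

Lemma lam_nondegl a : (forall b, lam (a * b) = 0) -> a = 0.
Proof.
move=> h; rewrite -[a]lam_casimirl; rewrite /sw big1 // => p _.
by rewrite h scale0r.
Qed.

Lemma lam_nondegr a : (forall b, lam (b * a) = 0) -> a = 0.
Proof.
move=> h; apply: (can_inj SK); apply: (can_inj SK); rewrite -lam_casimirr.
rewrite (lin0 Sl) (lin0 Sl) /sw big1 // => p _.
by rewrite h scale0r.
Qed.

Lemma slin_sw (t : H -> k) (f : H -> H -> H) x : slin t ->
  t (sw f x) = \sum_(p <- comul x) t (f p.1 p.2).
Proof. by move=> tl; rewrite /sw slin_sumE. Qed.

Lemma lam_expand x : sw (fun a b => lam (S b * x) *: a) L = x.
Proof.
apply/eqP; rewrite -subr_eq0; apply/eqP; apply: lam_nondegr => y.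
rewrite mulrBr slinB // -{2}(lam_casimirl y) /sw mulr_sumr mulr_suml !slin_sumE //.
apply/eqP; rewrite subr_eq0; apply/eqP; apply: eq_bigr => p _.
by rewrite -scalerAr -scalerAl !slinZ // mulrC.
Qed.

Lemma lam_nakayama a b : lam (b * a) = lam (S (S a) * b).
Proof.
rewrite -(lam_casimirr a) -{1}(lam_expand b) /sw !mulr_suml !slin_sumE //.
by apply: eq_bigr => p _; rewrite -!scalerAl !slinZ // mulrC.
Qed.

Lemma tr_lam f : lin f -> tr e c f = \sum_(p <- comul L) lam (S p.2 * f p.1).
Proof.
move=> fl; rewrite /tr.
under eq_bigr => i _.
  rewrite -{1}(lam_expand (e i)) /sw (lin_sumE fl) slin_sumE //.
  under eq_bigr do rewrite (linZ fl) slinZ //.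
  over.
rewrite exchange_big; apply: eq_bigr => p _ /=.
rewrite [in RHS](ec.2 (f p.1)) mulr_sumr slin_sumE //; apply: eq_bigr => i _.
by rewrite -scalerAr slinZ // mulrC.
Qed.

Lemma integral_unique (mu : H -> k) : slin mu ->
  (forall h, sw (fun a b => mu a *: b) h = mu h *: 1) -> forall h, mu h = mu L * lam h.
Proof.
move=> ml mI h.
have h1 : sw (fun a b => mu (h * a) *: S b) L = mu L *: h.
  rewrite (@integral_casimir k H L Lint.1 _ (fun a b => mu a *: b)); last by linp.
  rewrite (_ : sw _ L = S (sw (fun a b => mu a *: b) L) * h).
    by rewrite mI linZ // antipode1 -scalerAl mul1r.
  rewrite (@sw_out _ _ _ _ (fun z => S z * h)); last by linp.
  by apply: eq_sw => a b; rewrite linZ // scalerAl.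
rewrite -slinZ // -h1 -{1}[h]mulr1 -{1}(lam_expand 1) /sw mulr_sumr !slin_sumE //.
by apply: eq_bigr => p _; rewrite -scalerAr !slinZ // mulr1 mulrC.
Qed.

Definition modular : H := sw (fun a b => lam b *: a) L.
Local Notation g := modular.

Lemma lam_modular h : sw (fun a b => lam b *: a) h = lam h *: g.
Proof.
rewrite [LHS]ec.2 [RHS]ec.2; apply: eq_bigr => i _; congr (_ *: _).
pose mu x := c i (sw (fun a b => lam b *: a) x).
have swl : lin (sw (fun a b : H => lam b *: a)) by linp.
rewrite -/(mu h) (@integral_unique mu) ?slinZ //.
- by rewrite mulrC.
- by rewrite /mu; linp.
move=> x.
transitivity (sw (fun a b => sw (fun u v => c i u *: (lam v *: b)) a) x).
  apply: eq_sw => a b; rewrite /mu slin_sw // scaler_suml; apply: eq_bigr => p _.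
  by rewrite slinZ // scalerA mulrC.
rewrite swA; [|linp|linp|linp].
under eq_sw => u w do rewrite swZ lam_integral.
rewrite /mu slin_sw // scaler_suml; apply: eq_bigr => p _.
by rewrite slinZ // scalerA mulrC.
Qed.

Lemma modular_grouplike (W : lmodType k) (f : H -> H -> W) : bil f -> sw f g = f g g.
Proof.
move=> hf; rewrite {1}/modular (@sw_out _ _ _ _ (sw f)); last by linp.
transitivity (sw (fun a b => sw (fun u v => lam b *: f u v) a) L).
  by apply: eq_sw => a b; rewrite (linZ (lin_swx hf)) swZ.
rewrite swA; [|linp|linp|linp].
transitivity (sw (fun u w => f (lam w *: u) g) L).
  apply: eq_sw => u w; rewrite (linZ (hf.1 _)) -(linZ (hf.2 _)) -lam_modular.
  rewrite (@sw_out _ _ _ _ (f u)); last by linp.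
  by apply: eq_sw => a b; rewrite (linZ (hf.2 _)).
by rewrite -(@sw_out _ _ _ _ (f^~ g)); last by linp.
Qed.

Lemma eps_modular : eps g = 1.
Proof.
rewrite /modular slin_sw // -lamL -[in RHS](comul_counitl L) slin_sumE //.
by apply: eq_bigr => p _; rewrite !slinZ // mulrC.
Qed.

Lemma modular_mulVr : S g * g = 1.
Proof.
have := @sw_antl k H H (fun z => z) g (@lin_id _ _).
by rewrite modular_grouplike ?eps_modular ?scale1r //; linp.
Qed.
Lemma modular_mulrV : g * S g = 1.
Proof.
have := @sw_antr k H H (fun z => z) g (@lin_id _ _).
by rewrite modular_grouplike ?eps_modular ?scale1r //; linp.
Qed.

Lemma modular_grouplikeX (W : lmodType k) (f : H -> H -> W) l : bil f ->
  sw f (g ^+ l) = f (g ^+ l) (g ^+ l).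
Proof.
move=> hf; elim: l f hf => [|l IH] f hf; first by rewrite !expr0 sw1.
rewrite exprS swM // (@modular_grouplike _ (fun a b => sw (fun c d => f (a * c) (b * d)) (g ^+ l))).
  by rewrite (IH (fun c d => f (g * c) (g * d))) //; linp.
by linp.
Qed.

Lemma eps_modularX l : eps (g ^+ l) = 1.
Proof. by elim: l => [|l IH]; rewrite ?counit1 // exprS counitM IH eps_modular mulr1. Qed.

Definition conv (f1 f2 : H -> k) (h : H) : k := \sum_(p <- comul h) f1 p.1 * f2 p.2.

Lemma conv_bil f1 f2 : slin f1 -> slin f2 -> @bil k H k^o (fun a b => f1 a * f2 b).
Proof.
by move=> h1 h2; split=> [v|u]; [apply: (slin_mulr (f2 v) h1) | apply: (slin_mull (f1 u) h2)].
Qed.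

Lemma conv_lin f1 f2 : slin f1 -> slin f2 -> slin (conv f1 f2).
Proof. by move=> h1 h2; exact: (lin_swx (conv_bil h1 h2)). Qed.

Lemma conv_modularX f1 f2 l : slin f1 -> slin f2 ->
  conv f1 f2 (g ^+ l) = f1 (g ^+ l) * f2 (g ^+ l).
Proof. by move=> h1 h2; exact: (modular_grouplikeX l (conv_bil h1 h2)). Qed.

(* Distinct powers of g would be separated by convolution products of functionals,
   hence linearly independent. *)
Lemma modular_finite_order : exists2 N, (0 < N)%N & g ^+ N = 1.
Proof.
apply: contrapT => nfin.
have ginj (i j : nat) : i <> j -> g ^+ i <> g ^+ j.
  wlog ij : i j / (i < j)%N.
    move=> hw nij; case: (ltngtP i j) => [ij|ji|//]; first exact: hw.
    by move/esym; apply: hw => // /esym.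
  move=> _ eij; apply: nfin; exists (j - i)%N; first by rewrite subn_gt0.
  have : S g ^+ i * g ^+ i = 1.
    by rewrite -exprMn_comm ?modular_mulVr ?expr1n // /GRing.comm modular_mulrV modular_mulVr.
  by move=> h; rewrite -[LHS]mul1r -h -mulrA -exprD subnKC 1?ltnW // -eij.
have sep i j : exists f : H -> k, slin f /\ (i <> j -> f (g ^+ i) = 1 /\ f (g ^+ j) = 0).
  have [<-|ij] := pselect (i = j); first by exists (fun=> 0); split; [exact: slin_zero|].
  have [|t tl t1] := @separating_functional k H (g ^+ i - g ^+ j).
    by move/eqP; rewrite subr_eq0 => /eqP; apply: ginj.
  exists (fun x => t x - t (g ^+ j) * eps x); split; first by linp.
  by move=> _; rewrite !eps_modularX !mulr1 -slinB // t1 subrr.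
have sep' i : exists f : nat -> H -> k, forall j,
    slin (f j) /\ (i <> j -> f j (g ^+ i) = 1 /\ f j (g ^+ j) = 0).
  by have [f fP] := choice (sep i); exists f.
have [f fP] := choice sep'.
pose F i := foldr (fun j => if j == i then id else conv (f i j)) eps (iota 0 n.+1).
have Fl i r : slin (foldr (fun j => if j == i then id else conv (f i j)) eps r).
  elim: r => [|j r IH] //=; case: eqP => // _; apply: conv_lin => //.
  by have [] := fP i j.
have Fv i l r : foldr (fun j => if j == i then id else conv (f i j)) eps r (g ^+ l) =
    \prod_(j <- r | j != i) f i j (g ^+ l).
  elim: r => [|j r IH] /=; first by rewrite big_nil eps_modularX.
  rewrite big_cons; case: eqP => //= _; rewrite conv_modularX ?IH //.
  by have [] := fP i j.
suff : (n.+1 <= n)%N by rewrite ltnn.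
apply: (@biorth_bound k H n.+1 n (fun i => g ^+ i) (fun i => F i) e).
  split=> [i|i j]; first exact: Fl.
  rewrite /F Fv; case: eqVneq => [->|ij].
    by apply: big1 => l /eqP lj; have [_ /(_ (nesym lj))[]] := fP j l.
  apply/eqP; rewrite prodf_seq_eq0; apply/hasP; exists (val j).
    by rewrite mem_iota ltn_ord.
  rewrite eq_sym ij /=; apply/eqP; have [_ h2] := fP i j; have [|] := h2 => //.
  by move=> e0; move: ij; rewrite -val_eqE /= e0 eqxx.
by move=> i; exists (fun j => c j (g ^+ i)); apply: ec.2.
Qed.

(* h |-> lam (g * S h) is again an integral on H, hence proportional to lam; comparing
   the Nakayama automorphisms of both gives Radford's formula for S^4. *)
Lemma antipode4 x : S (S (S (S x))) * g = g * x.
Proof.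
pose mu h := lam (g * S h).
have ml : slin mu by rewrite /mu; linp.
have mI h : sw (fun a b => mu a *: b) h = mu h *: 1.
  have e0 : sw (fun a b => mu a *: (g * S b)) h = mu h *: g.
    rewrite /mu -lam_modular swM; last by linp.
    rewrite (@modular_grouplike _ (fun a b => sw (fun c0 d => lam (b * d) *: (a * c0)) (S h))); last by linp.
    by rewrite comul_antipode //; linp.
  apply: (can_inj SK); rewrite (@sw_out _ _ _ _ S) // linZ // antipode1.
  have := congr1 (fun z => S g * z) e0.
  rewrite (@sw_out _ _ _ _ (fun z => S g * z)); last by linp.
  rewrite -scalerAr modular_mulVr => <-; apply: eq_sw => a b.
  by rewrite -scalerAr mulrA modular_mulVr mul1r linZ.
have muE h : lam (g * S h) = mu L * lam h by apply: (integral_unique ml mI).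
have muL0 : mu L != 0.
  apply/eqP => m0; have := muE (T (S g * L)).
  rewrite m0 mul0r TK mulrA modular_mulrV mul1r lamL => /eqP; by rewrite oner_eq0.
suff h5 a : g * S a = S (S (S (S (S a)))) * g by rewrite -(TK x) h5.
apply/eqP; rewrite -subr_eq0; apply/eqP; apply: lam_nondegl => y.
rewrite -(TK y) mulrBl slinB // -!mulrA -antipodeM muE.
apply/eqP; rewrite subr_eq0; apply/eqP.
rewrite lam_nakayama -muE antipodeM mulrA lam_nakayama.
by rewrite !mulrA.
Qed.

End DualIntegral.

Lemma natr_inj_pchar0 (k : fieldType) : [pchar k] =i pred0 -> injective (fun m : nat => m%:R : k).
Proof.
move=> /pcharf0P ch m p; wlog mp : m p / (m <= p)%N.
  by move=> h e; case/orP: (leq_total m p) => [mp|pm]; [apply: h | apply/esym/h].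
move/esym/eqP; rewrite -subr_eq0 -natrB // ch subn_eq0 => pm.
by apply/eqP; rewrite eqn_leq mp.
Qed.

Section Involutive.
Variables (k : closedFieldType) (H : hopfAlgType k) (n : nat) (e : 'I_n -> H) (c : 'I_n -> H -> k).
Hypothesis ch : [pchar k] =i pred0.
Hypothesis ss : semisimple_algebra H.
Hypothesis ec : full_basis e c.
Variable L : H.
Hypotheses (Lint : two_sided_integral L) (epsL : counit L = 1).
Variable T : H -> H.
Hypotheses (Tlin : lin T) (SK : cancel (@antipode k H) T) (TK : cancel T (@antipode k H)).
Local Notation S := (@antipode k H).
Local Notation eps := (@counit k H).
Local Notation chi := (regular_trace e c).
Local Notation lam := (antipode_trace e c).
Local Notation g := (modular e c L).

Let cl i : slin (c i). Proof. exact: ec.1.1. Qed.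
Let Sl := @antipode_lin k H.
Let el := @counit_lin k H.
Let ll := lam_lin ec.
Let chil := chi_lin ec.

Lemma antipode2_inner : exists u w : H, [/\ u * w = 1, w * u = 1 & forall x, S (S x) = u * x * w].
Proof.
have [q [_ D1 D2 _]] := chi_dual_bases ec ch ss.
pose w := \sum_l lam (e l) *: q l.
have wE x : chi (w * x) = lam x.
  rewrite /w mulr_suml slin_sumE // -[in RHS](D1 x) // slin_sumE //.
  by apply: eq_bigr => l _; rewrite -scalerAl !slinZ // mulrC.
have winj x : x * w = 0 -> x = 0.
  move=> xw; apply: (lam_nondegr ec Lint epsL Tlin SK TK) => h.
  by rewrite -wE mulrA chiC // mulrA xw mul0r slin0.
have [||f [fl f1 f2]] := @lin_inj_bij _ _ _ _ _ ec (fun x => x * w).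
- by linp.
- by move=> x y xy; apply/eqP; rewrite -subr_eq0; apply/eqP/winj; rewrite mulrBl xy subrr.
have uw : f 1 * w = 1 by apply: f2.
have wu : w * f 1 = 1.
  by apply/eqP; rewrite -subr_eq0; apply/eqP/winj; rewrite mulrBl -mulrA uw mulr1 mul1r subrr.
exists (f 1), w; split=> // x.
suff E : x * w = w * S (S x) by rewrite -mulrA E mulrA uw mul1r.
apply/eqP; rewrite -subr_eq0; apply/eqP; apply: (chi_nondegenerate ec ch ss) => b.
rewrite mulrBl slinB // -[w * _ * _]mulrA wE -(lam_nakayama ec Lint epsL Tlin SK TK) -wE.
by rewrite -mulrA chiC // !mulrA subrr.
Qed.

Lemma tr_antipode2_neq0 : tr e c (fun x => S (S x)) <> 0.
Proof.
have [u [w [uw wu S2]]] := antipode2_inner.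
have [N N0 gN] := modular_finite_order ec Lint epsL Tlin SK TK.
rewrite (@eq_tr _ _ _ e c _ (fun x => u * x * w)) //.
apply: (tr_conj_neq0 ec ch ss (M := N.*2) _ uw wu _ el _ _ epsL Lint.1 Lint.2).
- by rewrite double_gt0.
- move=> x.
  have h1 l y : y * w ^+ l = w ^+ l * iter l (fun x => S (S x)) y.
    elim: l y => [|l IH] y; first by rewrite !expr0 mul1r mulr1.
    rewrite exprSr mulrA IH -mulrA iterS; set y' := iter _ _ _.
    by rewrite S2 -[RHS]mulrA ![w * _]mulrA wu mul1r.
  have h2 l y : iter l.*2 (fun x => S (S x)) y * g ^+ l = g ^+ l * y.
    elim: l y => [|l IH] y; first by rewrite !expr0 mul1r mulr1.
    rewrite doubleS !iterS exprS mulrA (antipode4 ec Lint epsL Tlin SK TK).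
    by rewrite -mulrA IH mulrA.
  by rewrite h1 -[iter _ _ _]mulr1 -gN h2 gN mul1r.
- exact: counit1.
- exact: counitM.
Qed.

Lemma lam1 : lam 1 = tr e c (fun x => S (S x)).
Proof. by apply: eq_tr => x; rewrite mulr1. Qed.

Lemma antipode4_id x : S (S (S (S x))) = x.
Proof.
have g1 : g = 1.
  have := lam_modular ec Lint epsL Tlin SK TK 1; rewrite sw1; last by linp.
  move/eqP; rewrite -subr_eq0 -scalerBr scaler_eq0 lam1 => /orP[/eqP/tr_antipode2_neq0 //|].
  by rewrite subr_eq0 => /eqP.
by have := antipode4 ec Lint epsL Tlin SK TK x; rewrite g1 mulr1 mul1r.
Qed.

Lemma sw_absorbr (W : lmodType k) (f : H -> H -> W) x h : bil f ->
  sw (fun a b => f a (b * x)) h = sw (fun p q => sw (fun u v => f (u * T p) v) (h * q)) x.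
Proof.
move=> hf.
under [RHS]eq_sw => p q.
  rewrite swM; last by linp.
  rewrite sw_swap; under eq_sw => q1 q2 do under eq_sw => a b do rewrite -mulrA.
  over.
rewrite -swA; [|linp|linp|linp].
have T1 : T 1 = 1 by rewrite -[X in T X]antipode1 SK.
under [RHS]eq_sw => w q2.
  rewrite (_ : sw _ w = eps w *: sw (fun a b => f a (b * q2)) h).
    over.
  have -> : sw (fun a b => f a (b * q2)) h = sw (fun a b => f (a * T 1) (b * q2)) h.
    by apply: eq_sw => ? ?; rewrite T1 mulr1.
  rewrite -(@sw_antr k H _ (fun z => sw (fun a b => f (a * T z) (b * q2)) h)); last by linp.
  apply: eq_sw => p q1; apply: eq_sw => a b; congr (f (_ * _) _).
  by apply: (can_inj SK); rewrite antipodeM !TK.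
by rewrite (@sw_counitl k H _ (fun q2 => sw (fun a b => f a (b * q2)) h)) //; linp.
Qed.

Lemma chi_conv h : sw (fun a b => (chi a * chi b) *: (1 : H)) h = (n%:R * chi h) *: 1.
Proof.
transitivity (\sum_i sw (fun a b => c i (b * e i) *: (chi a *: (1 : H))) h).
  rewrite sum_sw; apply: eq_sw => a b; rewrite -scaler_suml scalerA mulrC.
  by [].
under eq_bigr => i _.
  rewrite (@sw_absorbr _ (fun a b => c i b *: (chi a *: (1 : H)))); last by linp.
  over.
transitivity (\sum_i \sum_j sw (fun p q => sw (fun u v =>
    c j (h * q) *: (c i v *: (chi (T p * u) *: (1 : H)))) (e j)) (e i)).
  apply: eq_bigr => i _; rewrite sum_sw; apply: eq_sw => p q.
  rewrite (basis_expand ec); last by linp.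
  apply: eq_bigr => j _; rewrite -swZ; apply: eq_sw => u v.
  by rewrite chiC.
rewrite exchange_big.
transitivity (\sum_j sw (fun u v => sw (fun p q => c j (h * q) *: (chi (T p * u) *: (1 : H))) v) (e j)).
  apply: eq_bigr => j _.
  under eq_bigr do rewrite sw_swap.
  rewrite sum_sw; apply: eq_sw => u v.
  rewrite [RHS](basis_expand ec); last by linp.
  apply: eq_bigr => i _; rewrite -swZ; apply: eq_sw => a b.
  by rewrite !scalerA [c j _ * _]mulrC.
transitivity (\sum_j (c j (h * e j) * chi 1) *: (1 : H)); last first.
  rewrite -scaler_suml -mulr_suml mulrC; congr (_ * _ *: _).
  by rewrite /regular_trace -[in RHS](card_ord n) -(tr_id ec); apply: eq_tr => x; rewrite mul1r.
apply: eq_bigr => j _.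
rewrite -swA; [|linp|linp|linp].
under eq_sw => w q.
  rewrite (@sw_inv_antipode k H T Tlin SK TK _ (fun z => c j (h * q) *: (chi z *: (1 : H)))); last by linp.
  over.
by rewrite (@sw_counitl k H _ (fun q => c j (h * q) *: (chi 1 *: (1 : H)))) ?scalerA //; linp.
Qed.

Definition chi_proj h := n%:R^-1 *: sw (fun a b => chi a *: b) h.
Local Notation Q := chi_proj.

Let n0 : (0 < n)%N.
Proof.
case: n e c ec => // e' c' ec'; have := @ec'.2 1; rewrite big_ord0 => h.
by have := @counit1 k H; rewrite h (slin0 el) => /eqP; rewrite eq_sym oner_eq0.
Qed.

Let nk0 : n%:R != 0 :> k.
Proof. by have /pcharf0P -> := ch; rewrite -lt0n. Qed.

Lemma chi_proj_lin : lin Q.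
Proof. by rewrite /chi_proj; linp. Qed.

Lemma chi_proj_idem h : Q (Q h) = Q h.
Proof.
rewrite {1}/chi_proj {1}/chi_proj (linZ (lin_swx _)); last by linp.
congr (_ *: _).
transitivity (n%:R^-1 *: sw (fun a b => sw (fun u v => (chi a * chi u) *: v) b) h).
  congr (_ *: _); rewrite (@sw_out _ _ _ _ (sw (fun a b => chi a *: b))); last by linp.
  apply: eq_sw => a b; rewrite (linZ (lin_swx _)); last by linp.
  by rewrite -swZ; apply: eq_sw => u v; rewrite scalerA.
rewrite -swA; [|by linp..].
rewrite -swZ; apply: eq_sw => a v.
transitivity (n%:R^-1 *: (sw (fun a b => (chi a * chi b) *: (1 : H)) a * v)).
  rewrite (@sw_out _ _ _ _ (fun z => z * v)); last by linp.
  by congr (_ *: _); apply: eq_sw => ? ?; rewrite mulr_algl.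
by rewrite chi_conv mulr_algl scalerA mulrA mulVf // mul1r.
Qed.

Lemma chi_proj_antipode2 h : Q (S (S h)) = S (S (Q h)).
Proof.
have [u [w [uw wu S2]]] := antipode2_inner.
rewrite /chi_proj !linZ //; congr (_ *: _).
rewrite comul_antipode2; last by linp.
rewrite (@sw_out _ _ _ _ (fun z => S (S z))); last by linp.
apply: eq_sw => a b; rewrite !linZ //; congr (_ *: _).
by rewrite S2 chiC // mulrA wu mul1r.
Qed.

Lemma regular_trace_integral : chi L = 1.
Proof.
rewrite /regular_trace /tr; under eq_bigr do rewrite Lint.2 (slinZ (cl _)).
rewrite -[RHS]epsL [in RHS](ec.2 L) (slin_sumE el); apply: eq_bigr => l _.
by rewrite slinZ // mulrC.
Qed.

Lemma tr_antipode2_proj :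
  tr e c (fun x => S (S (Q x))) = n%:R^-1 * tr e c (fun x => S (S x)).
Proof.
rewrite (tr_lam ec Lint epsL Tlin SK TK); last first.
  have := chi_proj_lin; by move=> ?; linp.
rewrite -(slin_sumE ll).
rewrite (_ : \sum_(p <- _) _ = sw (fun a b => S b * S (S (Q a))) L) //.
transitivity (lam (n%:R^-1 *: sw (fun a b => sw (fun u v => chi u *: S (S v * b)) a) L)).
  congr (antipode_trace _ _ _); rewrite -swZ; apply: eq_sw => a b.
  rewrite /chi_proj !(linZ Sl) -scalerAr; congr (_ *: _).
  rewrite (@sw_out _ _ _ _ (fun z => S b * S (S z))); last by linp.
  by apply: eq_sw => u v; rewrite !(linZ Sl) -scalerAr antipodeM.
rewrite swA; [|by linp..].
under eq_sw => u w.
  rewrite (@sw_antl k H _ (fun z => chi u *: S z)); last by linp.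
  over.
rewrite (@sw_counitr k H _ (fun u => chi u *: S 1)); last by linp.
by rewrite regular_trace_integral antipode1 scale1r slinZ // lam1.
Qed.

Lemma antipode_involutive x : S (S x) = x.
Proof.
have n2 : (2%:R : k) != 0 by have /pcharf0P -> := ch.
pose P x := 2%:R^-1 *: (x - S (S x)).
have Pl : lin P by rewrite /P; linp.
have Ql := chi_proj_lin.
have two (y : H) : 2%:R^-1 *: (y + y) = y by rewrite -mulr2n -scaler_nat scalerA mulVf ?scale1r.
have PP y : P (P y) = P y.
  rewrite {1}/P -[RHS]two; congr (_ *: (_ + _)).
  rewrite /P !(linZ Sl) -scalerN; congr (_ *: _).
  by rewrite !(linB Sl) antipode4_id opprB.
have PQ y : Q (P y) = P (Q y) by rewrite /P (linZ Ql) (linB Ql) chi_proj_antipode2.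
have QP y : P (Q (P (Q y))) = P (Q y) by rewrite -PQ PP PQ chi_proj_idem.
have [r [trP rn r0]] := tr_idem ec Pl PP.
have [q [trQ _ _]] := tr_idem ec Ql chi_proj_idem.
have [s [trPQ _ _]] := tr_idem ec (lin_comp Pl Ql) QP.
have SP y : S (S y) = y - 2%:R *: P y.
  by rewrite /P scalerA mulfV // scale1r opprB addrC subrK.
have trS f : lin f -> tr e c (fun x => S (S (f x))) = tr e c f - 2%:R * tr e c (fun x => P (f x)).
  move=> fl; rewrite /tr mulr_sumr -sumrB; apply: eq_bigr => i _.
  by rewrite SP slinB // slinZ.
have e1 := trS _ (@lin_id _ _); rewrite (tr_id ec) card_ord trP in e1.
have e2 := trS _ Ql; rewrite tr_antipode2_proj trQ trPQ e1 in e2.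
have natE : (n * q + 2 * r = n + n * (2 * s))%N.
  apply: (natr_inj_pchar0 ch); rewrite natrD [RHS]natrD !natrM.
  have := congr1 (fun y => n%:R * y) e2; rewrite /= mulVKf // mulrBr => e3.
  by rewrite -[n%:R * q%:R in LHS](subrK (n%:R * (2%:R * s%:R))) -e3 addrAC subrK.
rewrite card_ord in rn.
have [qs|qs] := eqVneq q (2 * s)%N.
  case: tr_antipode2_neq0; rewrite e1; move: natE; rewrite qs addnC => /addIn <-.
  by rewrite natrM subrr.
have P0 y : P y = 0 -> S (S y) = y by move=> h; rewrite SP h scaler0 subr0.
have [lt|lt|e0] := ltngtP q (2 * s)%N; last by rewrite e0 eqxx in qs.
- have nr : (n <= r)%N.
    have /subnK qE := lt; move: natE; rewrite -qE addnS -addSn mulnDr addnA.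
    rewrite [(n * q + 2 * r)%N]addnC => /addIn h; nia.
  have {nr rn}rE : r = n by apply/eqP; rewrite eqn_leq rn.
  pose P' y := y - P y.
  have P'l : lin P' by rewrite /P'; linp.
  have [|r' [trP' _ r'0]] := tr_idem ec P'l.
    by move=> y; rewrite /P' (linB Pl) PP subrr subr0.
  have := trP'; rewrite {1}/P'; have -> : tr e c (fun y => y - P y) = n%:R - r%:R.
    have tn : tr e c (fun x => x) = n%:R by rewrite (tr_id ec) card_ord.
    rewrite -trP -tn /tr -sumrB; apply: eq_bigr => i _.
    by rewrite slinB.
  rewrite rE subrr => /(natr_inj_pchar0 ch (x1 := 0%N)) /esym /r'0 /(_ 1) /eqP.
  rewrite /P' /P !antipode1 subrr scaler0 subr0 => /eqP h.
  by have /eqP := @counit1 k H; rewrite h (slin0 el) eq_sym oner_eq0.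
- apply: P0; apply: r0; nia.
Qed.


End Involutive.

(** * Hopf subalgebras *)

Definition normalized_integral (k : fieldType) (H : hopfAlgType k) (t : H -> k) :=
  [/\ slin t, forall a b, t (a * b) = t (b * a), t 1 = 1
    & forall h, sw (fun a b => t a *: b) h = t h *: 1].

Lemma exists_normalized_integral (k : closedFieldType) (H : hopfAlgType k) :
  has_pchar0 k -> semisimple_algebra H ->
  exists n (e : 'I_n -> H) c (t : H -> k), full_basis e c /\ normalized_integral t.
Proof.
move=> ch ss; have [L Lint epsL] := exists_integral ss.
have [n [e [c ec]]] := finite_dimensional Lint.1 epsL.
have [T [Tl SK TK]] := lin_inj_bij ec (@antipode_lin k H) (antipode_inj Lint.1 epsL Lint.2).
have n0 : (n%:R : k) != 0.
  have /pcharf0P -> := ch; apply/eqP => n0; move: e c ec; rewrite n0 => e c ec.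
  by have /eqP := @counit1 k H; rewrite (ec.2 1) big_ord0 (slin0 (@counit_lin _ _)) eq_sym oner_eq0.
have ll := lam_lin ec.
have S2 := antipode_involutive ch ss ec Lint epsL Tl SK TK.
have lamE x : antipode_trace e c x = tr e c (fun y => y * x) by apply: eq_tr => y; rewrite S2.
exists n, e, c, (fun x => n%:R^-1 * antipode_trace e c x); split=> //; split.
- by linp.
- by move=> a b; rewrite (lam_nakayama ec Lint epsL Tl SK TK) S2.
- by rewrite lamE (@eq_tr _ _ _ e c _ (fun x => x)) ?(tr_id ec) ?card_ord ?mulVf // => x; rewrite mulr1.
- move=> h; rewrite -scalerA -(lam_integral ec Tl SK TK) -swZ.
  by apply: eq_sw => a b; rewrite scalerA.
Qed.

Section HopfSubalgebra.
Variables (k : fieldType) (H : hopfAlgType k) (n : nat) (e : 'I_n -> H) (c : 'I_n -> H -> k).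
Hypothesis ec : full_basis e c.
Variable t : H -> k.
Hypothesis tI : normalized_integral t.
Variable K : {pred H}.
Hypothesis hK : hopf_subalgebra K.
Local Notation S := (@antipode k H).
Local Notation eps := (@counit k H).

Let tl : slin t. Proof. by case: tI. Qed.
Let tC a b : t (a * b) = t (b * a). Proof. by case: tI. Qed.
Let t1 : t 1 = 1. Proof. by case: tI. Qed.
Let tint h : sw (fun a b => t a *: b) h = t h *: 1. Proof. by case: tI. Qed.
Let Sl := @antipode_lin k H.
Let el := @counit_lin k H.

Lemma hopf_subalgebra1 : 1 \in K. Proof. by case: hK => -[]. Qed.
Lemma hopf_subalgebraM : {in K &, forall a b, a * b \in K}. Proof. by case: hK => -[]. Qed.
Lemma hopf_subalgebraS : {in K, forall a, S a \in K}. Proof. by case: hK. Qed.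
Lemma hopf_subalgebra_comul : {in K, forall a, tens_in K (comul a)}. Proof. by case: hK. Qed.
Lemma hopf_subalgebra_subspace : subspace K.
Proof.
have [[h1 h2 _] _ _] := hK; split=> [|d x y xK yK]; last exact: h2.
by have := h2 (-1) _ _ h1 h1; rewrite scaleN1r addNr.
Qed.
Let K1 := hopf_subalgebra1.
Let KM := hopf_subalgebraM.
Let KS := hopf_subalgebraS.
Let Kd := hopf_subalgebra_comul.
Let sK := hopf_subalgebra_subspace.

Lemma sw_left_leg (phi : H -> k) x : slin phi -> x \in K -> sw (fun a b => phi b *: a) x \in K.
Proof.
move=> pl xK; have [s es sK'] := Kd xK.
rewrite /sw (es _ (fun a b => phi b *: a)); last by apply: bil_bilinear; linp.
by rewrite big_seq; apply: subspace_sum => // p /sK' [pK _]; apply: subspaceZ.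
Qed.

(* The radical of t on K is an ideal and a right coideal of K; such a proper N
   vanishes since eps x = x1 S(x2) puts eps(N) into N. *)
Lemma integral_nondegenerate : {in K, forall a, {in K, forall b, t (a * b) = 0} -> a = 0}.
Proof.
have step1 x y : {in K, forall b, t (x * b) = 0} -> y \in K ->
    sw (fun a b => t (a * y) *: b) x = 0.
  move=> xN yK.
  transitivity (sw (fun u v => t (x * u) *: S v) y); last first.
    rewrite (@eq_sw_in k H K H _ (fun _ _ => 0)) ?/sw ?big1 //; try by linp.
      exact: Kd.
    by move=> a b aK _; rewrite xN // scale0r.
  transitivity (sw (fun u v => sw (fun p q => sw (fun a b => t (a * p) *: (b * (q * S v))) x) u) y).
    rewrite swA; [|by linp..].
    under [RHS]eq_sw => p w.
      rewrite (@sw_antr k H _ (fun z => sw (fun a b => t (a * p) *: (b * z)) x)); last by linp.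
      over.
    rewrite (@sw_counitr k H _ (fun p => sw (fun a b => t (a * p) *: (b * 1)) x)); last by linp.
    by apply: eq_sw => a b; rewrite mulr1.
  apply: eq_sw => u v; rewrite sw_swap.
  rewrite -[t (x * u) *: S v]mulr_algl -tint swM; last by linp.
  rewrite (@sw_out _ _ _ _ (fun z => z * S v)); last by linp.
  apply: eq_sw => a b.
  rewrite (@sw_out _ _ _ _ (fun z => z * S v)); last by linp.
  by apply: eq_sw => p q; rewrite -scalerAl mulrA.
have step2 x phi y : {in K, forall b, t (x * b) = 0} -> slin phi -> y \in K ->
    t (sw (fun a b => phi b *: a) x * y) = 0.
  move=> xN pl yK.
  transitivity (phi (sw (fun a b => t (a * y) *: b) x)); last by rewrite step1 // slin0.
  rewrite /sw mulr_suml !slin_sumE //.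
  by apply: eq_bigr => p _; rewrite -scalerAl !slinZ // mulrC.
have [m [f [d [[dl _] fK dE]]]] := @exists_basis_on k H K n e sK
  (fun x _ => ex_intro _ (fun j => c j x) (ec.2 x)).
have step3 x : x \in K -> {in K, forall b, t (x * b) = 0} -> eps x = 0.
  move=> xK xN.
  have : sw (fun a b => a * S b) x = eps x *: 1 by rewrite (@sw_antr k H _ (fun z => z)).
  move/(congr1 t); rewrite slinZ // t1 mulr1 => <-.
  rewrite (@eq_sw_in k H K H _ (fun a b => \sum_j d j b *: (a * S (f j)))); first last.
  - move=> a b aK bK; rewrite {1}(dE b bK) (lin_sumE Sl) mulr_sumr.
    by apply: eq_bigr => j _; rewrite (linZ Sl) -scalerAr.
  - exact: Kd.
  - by linp.
  - by linp.
  rewrite -sum_sw slin_sumE // big1 // => j _.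
  rewrite -[RHS](step2 x (d j) (S (f j))) ?KS //; congr t.
  rewrite [RHS](@sw_out _ _ _ _ (fun z => z * S (f j))); last by linp.
  by apply: eq_sw => a b; rewrite -scalerAl.
move=> x xK xN; rewrite [x]ec.2 big1 // => i _.
have cl := ec.1.1 i.
have z0 : eps (sw (fun a b => c i b *: a) x) = 0.
  by apply: step3; [apply: sw_left_leg | move=> b bK; apply: step2].
have -> : c i x = eps (sw (fun a b => c i b *: a) x); last by rewrite z0 scale0r.
rewrite -{1}(comul_counitl x) (slin_sumE cl) /sw (slin_sumE el).
by apply: eq_bigr => p _; rewrite (slinZ cl) (slinZ el) mulrC.
Qed.

Lemma exists_sub_dual_bases : exists m (f q : 'I_m -> H),
  [/\ dual_bases K t f q, \sum_l f l * q l = m%:R,  \sum_l q l * f l = m%:R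
    & exists L, [/\ L \in K, L * L = m%:R *: L & t L = 1]].
Proof.
have [m [f [d fd]]] := @exists_basis_on k H K n e sK
  (fun x _ => ex_intro _ (fun j => c j x) (ec.2 x)).
have [q [qK D1 D2 D3]] := exists_dual_basis sK fd tl integral_nondegenerate.
have fK : forall l, f l \in K by case: fd.
have D : dual_bases K t f q by split.
pose L := \sum_l eps (f l) *: q l.
have LK : L \in K by apply: subspace_sum => // l _; apply: subspaceZ.
have tL x : x \in K -> t (L * x) = eps x.
  move=> xK; rewrite -[in RHS](D1 x xK) /L mulr_suml !slin_sumE //.
  by apply: eq_bigr => l _; rewrite -scalerAl !slinZ // mulrC.
have Lint : {in K, forall x, x * L = eps x *: L}.
  move=> x xK; apply/eqP; rewrite -subr_eq0; apply/eqP.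
  apply: integral_nondegenerate; first by apply: subspaceB => //; [apply: KM | apply: subspaceZ].
  move=> b bK; rewrite mulrBl slinB // -mulrA tC -mulrA tL ?KM // -scalerAl slinZ // tL //.
  by rewrite counitM mulrC subrr.
have tL1 : t L = 1 by rewrite -[L]mulr1 tL ?counit1.
have fq : \sum_l f l * q l = eps L *: 1.
  have qE l : q l = sw (fun a b => t (q l * a) *: S b) L.
    rewrite (@left_integral_casimir k H K _ (fun a b => t a *: b) L) //; last by linp.
    rewrite (_ : sw _ L = S (sw (fun a b => t a *: b) L) * q l).
      by rewrite tint tL1 scale1r antipode1 mul1r.
    rewrite (@sw_out _ _ _ _ (fun z => S z * q l)); last by linp.
    by apply: eq_sw => a b; rewrite (linZ Sl) scalerAl.
  rewrite -(@sw_antr k H _ (fun z => z)) //.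
  transitivity (\sum_l sw (fun a b => t (q l * a) *: (f l * S b)) L).
    apply: eq_bigr => l _; rewrite {1}qE (@sw_out _ _ _ _ (fun z => f l * z)); last by linp.
    by apply: eq_sw => a b; rewrite -scalerAr.
  rewrite sum_sw; apply: (@eq_sw_in k H K); [by linp | by linp | exact: Kd |].
  move=> a b aK bK; rewrite -[in RHS](D1 a aK) mulr_suml.
  by apply: eq_bigr => l _; rewrite -scalerAl.
have epsL : eps L = m%:R.
  have := congr1 t fq; rewrite slinZ // t1 mulr1 => <-.
  rewrite slin_sumE //; under eq_bigr do rewrite tC D3 eqxx.
  by rewrite sumr_const card_ord.
exists m, f, q; split=> //.
- by rewrite fq epsL scaler_nat.
- rewrite -(@dual_bases_sym k H K t m f q D H (fun a b => a * b)); [|by linp|by move=> ? ? _ _].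
  by rewrite fq epsL scaler_nat.
- by exists L; split=> //; rewrite Lint // epsL.
Qed.

End HopfSubalgebra.

Lemma hopf_subalgebra_predT (k : fieldType) (H : hopfAlgType k) :
  hopf_subalgebra (predT : {pred H}).
Proof. by split=> // x _; exists (comul x). Qed.

Section Subalgebra.
Variables (k : fieldType) (A : algType k) (R : {pred A}).
Hypothesis sR : subalg_closed R.

Lemma subalg_subspace : subspace R.
Proof.
have [h1 h2 _] := sR; split=> [|d x y xR yR]; last exact: h2.
by have := h2 (-1) _ _ h1 h1; rewrite scaleN1r addNr.
Qed.

Lemma subalg_horner a p : a \in R -> horner_alg a p \in R.
Proof.
have [h1 _ hM] := sR; move=> aR.
have aX i : a ^+ i \in R by elim: i => [|i IH]; rewrite ?expr0 // exprS hM.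
rewrite -[p]coefK poly_def linear_sum /=.
apply: subspace_sum; [exact: subalg_subspace | move=> i _].
rewrite linearZ /= rmorphXn /= horner_algX mulr_algl.
by apply: subspaceZ; [exact: subalg_subspace | apply: aX].
Qed.
End Subalgebra.

Section TracialSubalgebra.
Variables (k : closedFieldType) (A : algType k) (n : nat) (X Y : 'I_n -> A) (t : A -> k).
Hypotheses (ch : [pchar k] =i pred0) (n0 : (n%:R : k) != 0).
Hypotheses (tl : slin t) (tC : forall a b, t (a * b) = t (b * a)).
Hypotheses (XY : dual_bases predT t X Y) (sumXY : \sum_l X l * Y l = n%:R).
Variable R : {pred A}.
Hypothesis sR : subalg_closed R.
Hypothesis tR : {in R, forall a, {in R, forall b, t (a * b) = 0} -> a = 0}.

Let ec := dual_bases_full tl XY.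

Lemma trace_nilpotent a s : a ^+ s = 0 -> t a = 0.
Proof.
move=> as0; have := chi_nilpotent ec as0.
rewrite /regular_trace /tr; under eq_bigr do rewrite tC -mulrA.
rewrite -slin_sumE // -mulr_sumr sumXY mulr_natr.
rewrite -[a *+ n]scaler_nat slinZ // => /eqP; rewrite mulf_eq0 (negPf n0) => /eqP.
by [].
Qed.

(* The Casimir element \sum_l e_l q_l of R is invertible: an idempotent f of its
   annihilator satisfies tr_R(f) = t(f \sum_l e_l q_l) = 0, so by Fitting's lemma the
   annihilator consists of nilpotent elements. *)
Lemma strongly_separable_of_trace : strongly_separable_algebra R.
Proof.
split=> //; have sR' := subalg_subspace sR; have [R1 _ RM] := sR.
have [s [e [d ed]]] := @exists_basis_on k A R n X sR'
  (fun x _ => ex_intro _ _ (ec.2 x)).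
have [q [qR D1 D2 D3]] := exists_dual_basis sR' ed tl tR.
have eR : forall l, e l \in R by case: ed.
have D : dual_bases R t e q by split.
pose cas := \sum_l e l * q l.
have casR : cas \in R by apply: subspace_sum => // l _; apply: RM.
have casC x : x \in R -> x * cas = cas * x.
  move=> xR; rewrite /cas mulr_sumr mulr_suml.
  have := dual_bases_casimir D (f := fun u v => u * v) (x := x).
  move=> h; under eq_bigr do rewrite mulrA; rewrite h //; last by linp.
  by apply: eq_bigr => l _; rewrite mulrA.
pose rho h := \sum_l t (q l * h) *: e l.
have rhol : lin rho by rewrite /rho; linp.
have rhoR h : rho h \in R by apply: subspace_sum => // l _; apply: subspaceZ.
have rhoE x : x \in R -> rho x = x by apply: D1.
have casinj x : x \in R -> x * cas = 0 -> x = 0.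
  move=> xR xc; apply: tR => // y yR; set a := x * y.
  have aR : a \in R by apply: RM.
  have ac : a * cas = 0 by rewrite /a -mulrA casC // mulrA xc mul0r.
  have [r [u [ff af]]] := fitting_idempotent ec a.
  set f := horner_alg a _ in ff af.
  have fR : f \in R by apply: subalg_horner.
  have fc : f * cas = 0.
    by rewrite /f exprSr mulrA rmorphM /= horner_algX -mulrA ac mulr0.
  have [||m [trm _ m0]] := tr_idem (f := fun h => f * rho h) ec.
  - by linp.
  - by move=> h; rewrite rhoE ?RM // mulrA ff.
  suff f0 : f = 0 by apply: (@trace_nilpotent _ r.+1); rewrite af f0 mulr0.
  have tr0 : m%:R = 0 :> k.
    rewrite -trm /tr.
    transitivity (\sum_l t (q l * (f * e l))).
      transitivity (\sum_i \sum_l t (Y i * (f * e l)) * t (q l * X i)).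
        apply: eq_bigr => i _; rewrite /rho !mulr_sumr slin_sumE //.
        by apply: eq_bigr => l _; rewrite -!scalerAr slinZ // mulrC.
      rewrite exchange_big; apply: eq_bigr => l _ /=.
      rewrite [in RHS](ec.2 (f * e l)) mulr_sumr slin_sumE //.
      by apply: eq_bigr => i _; rewrite -scalerAr slinZ.
    transitivity (t (f * cas)); last by rewrite fc slin0.
    rewrite /cas mulr_sumr slin_sumE //.
    by apply: eq_bigr => l _; rewrite tC mulrA.
  have m00 : m = 0%N by apply: (natr_inj_pchar0 ch).
  by have := m0 m00 1; rewrite rhoE // mulr1.
have rhorho h : rho (rho h) = rho h by apply: rhoE.
have rhocas h : rho (rho h * cas) = rho h * cas by apply: rhoE; apply: RM.
have rhoG h : rho ((h - rho h) + rho h * cas) = rho h * cas.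
  by rewrite (linD rhol) (linB rhol) rhorho subrr add0r rhocas.
have [||G [Gl G1 G2]] := @lin_inj_bij _ _ _ _ _ ec (fun h => (h - rho h) + rho h * cas).
- by linp.
- move=> x y xy; have rxy : rho x = rho y.
    apply/eqP; rewrite -subr_eq0; apply/eqP; apply: casinj.
      by rewrite -(linB rhol).
    by rewrite mulrBl -(rhoG x) xy rhoG subrr.
  move: xy; rewrite rxy => /addIr; exact: addIr.
pose b := rho (G 1).
have bcas : b * cas = 1 by rewrite /b -rhoG G2 rhoE.
have bR : b \in R by apply: rhoR.
have bC y : y \in R -> b * y = y * b.
  move=> yR; rewrite -[LHS]mulr1 -{1}bcas -[b * y * _]mulrA [b * cas]casC // [y * (cas * b)]mulrA.
  by rewrite casC // !mulrA bcas mul1r.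
exists [seq (b * e l, q l) | l <- enum 'I_s]; first split.
- by move=> _ /mapP[l _ ->] /=; split; [apply: RM | apply: qR].
- rewrite big_map big_enum /= -bcas /cas mulr_sumr.
  by apply: eq_bigr => l _; rewrite mulrA.
- move=> r rR W f [fl fr]; rewrite 2![LHS]big_map 2![RHS]big_map !big_enum /=.
  have := dual_bases_casimir D (f := fun u v => f (b * u) v) (x := r) _ RM rR.
  have fb : bil f by split=> [v c' x y|u c' x y]; [apply: fl | apply: fr].
  by move=> <-; [apply: eq_bigr => l _; rewrite !mulrA bC | linp].
move=> W f [fl fr]; rewrite 2![LHS]big_map [RHS]big_map !big_enum /=.
have fb : bil f by split=> [v c' x y|u c' x y]; [apply: fl | apply: fr].
rewrite -(dual_bases_sym D (f := fun u v => f u (b * v))); [|by linp|by move=> ? ? _ _].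
have := dual_bases_casimir D (f := f) (x := b) fb RM bR => ->.
by apply: eq_bigr => l _; rewrite bC.
Qed.

Lemma separable_of_strongly_separable : strongly_separable_algebra R -> separable_algebra R.
Proof. by case=> ? [s ? _]; split=> //; exists s. Qed.

End TracialSubalgebra.

(** * Modules with equal characters *)

Section Intertwiners.
Variables (k : fieldType) (A : algType k) (K : {pred A}) (t : A -> k) (m : nat) (f q : 'I_m -> A).
Hypothesis ch : [pchar k] =i pred0.
Hypotheses (m0 : (m%:R : k) != 0) (sK : subalg_closed K).
Hypotheses (D : dual_bases K t f q) (sumfq : \sum_l f l * q l = m%:R).

Definition representation N (rho : A -> 'M[k]_N) :=
  [/\ lin rho, {in K &, forall x y, rho (x * y) = rho x *m rho y} & rho 1 = 1%:M].

Definition intertwiner N1 N2 (rho1 : A -> 'M[k]_N1) (rho2 : A -> 'M[k]_N2) (B : 'M_(N1, N2)) :=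
  {in K, forall x, rho1 x *m B = B *m rho2 x}.

Definition avg N1 N2 (rho1 : A -> 'M[k]_N1) (rho2 : A -> 'M[k]_N2) (B : 'M_(N1, N2)) :=
  m%:R^-1 *: \sum_l rho1 (f l) *m B *m rho2 (q l).

Let fK l : f l \in K. Proof. by case: D => -[]. Qed.
Let qK l : q l \in K. Proof. by case: D => -[]. Qed.

Lemma lin_mulmxl (V : lmodType k) N1 N2 N3 (g : V -> 'M[k]_(N1, N2)) (B : 'M_(N2, N3)) :
  @lin k V _ g -> lin (fun x => g x *m B).
Proof. by move=> gl c u v; rewrite gl mulmxDl scalemxAl. Qed.

Lemma lin_mulmxr (V : lmodType k) N1 N2 N3 (g : V -> 'M[k]_(N2, N3)) (B : 'M_(N1, N2)) :
  @lin k V _ g -> lin (fun x => B *m g x).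
Proof. by move=> gl c u v; rewrite gl mulmxDr scalemxAr. Qed.

Section Pair.
Variables (N1 N2 : nat) (rho1 : A -> 'M[k]_N1) (rho2 : A -> 'M[k]_N2).
Hypotheses (r1 : representation rho1) (r2 : representation rho2).

Lemma avg_intertwiner B : intertwiner rho1 rho2 (avg rho1 rho2 B).
Proof.
have [l1 M1 _] := r1; have [l2 M2 _] := r2; have [_ _ KM] := sK.
move=> x xK; rewrite /avg -scalemxAr -scalemxAl mulmx_sumr mulmx_suml; congr (_ *: _).
have h := dual_bases_casimir D (f := fun u v => rho1 u *m B *m rho2 v) (x := x) _ KM xK.
transitivity (\sum_l rho1 (x * f l) *m B *m rho2 (q l)).
  by apply: eq_bigr => l _; rewrite M1 // !mulmxA.
rewrite h; first by apply: eq_bigr => l _; rewrite M2 // !mulmxA.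
split=> [v|u]; last exact: lin_mulmxr.
by do 2!apply: lin_mulmxl.
Qed.

Lemma avg_fix B : intertwiner rho1 rho2 B -> avg rho1 rho2 B = B.
Proof.
have [l1 M1 e1] := r1 => hB.
rewrite /avg; under eq_bigr do rewrite -mulmxA -hB // mulmxA -M1 //.
rewrite -mulmx_suml -(lin_sumE l1) sumfq -scaler_nat (linZ l1) e1.
by rewrite -scalemxAl mul1mx scalerA mulVf ?scale1r.
Qed.

Lemma avg_mul N0 N3 (rho0 : A -> 'M[k]_N0) (rho3 : A -> 'M[k]_N3) B C E :
  intertwiner rho0 rho1 C -> intertwiner rho2 rho3 E ->
  C *m avg rho1 rho2 B *m E = avg rho0 rho3 (C *m B *m E).
Proof.
move=> hC hE; rewrite /avg -scalemxAr -scalemxAl mulmx_sumr mulmx_suml; congr (_ *: _).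
by apply: eq_bigr => l _; rewrite !mulmxA -hC // -!mulmxA hE.
Qed.

Lemma mul_delta_mx_entry (C : 'M[k]_N1) (E : 'M_N2) i j :
  (C *m delta_mx i j *m E) i j = C i i * E j j.
Proof.
rewrite mxE (bigD1 j) //= mxE (bigD1 i) //= !mxE !eqxx mulr1.
rewrite !big1 ?addr0 // => [l lj|l li]; rewrite ?mxE ?(negPf li) ?mulr0 //.
rewrite big1 ?mul0r // => l' _; by rewrite mxE (negPf lj) andbF mulr0.
Qed.

Lemma sum_avg_delta p p' :
  \sum_i \sum_j (p *m avg rho1 rho2 (delta_mx i j) *m p') i j =
  m%:R^-1 * \sum_l \tr (p *m rho1 (f l)) * \tr (rho2 (q l) *m p').
Proof.
rewrite mulr_sumr.
transitivity (\sum_i \sum_j \sum_l m%:R^-1 * ((p *m rho1 (f l)) i i * (rho2 (q l) *m p') j j)).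
  apply: eq_bigr => i _; apply: eq_bigr => j _.
  rewrite /avg -scalemxAr -scalemxAl mxE mulmx_sumr mulmx_suml summxE mulr_sumr.
  by apply: eq_bigr => l _; rewrite -mul_delta_mx_entry !mulmxA.
under eq_bigr do rewrite exchange_big.
rewrite exchange_big; apply: eq_bigr => l _ /=.
rewrite mulr_suml mulr_sumr; apply: eq_bigr => i _.
by rewrite -mulr_sumr -mulr_sumr.
Qed.

End Pair.

Lemma mx_full_basis N : full_basis (fun ij : 'I_N * 'I_N => delta_mx ij.1 ij.2 : 'M[k]_N)
  (fun ij B => B ij.1 ij.2).
Proof.
split; first split.
- by move=> i d B C; rewrite !mxE.
- by move=> [i j] [i' j']; rewrite mxE /= xpair_eqE.
by move=> B; rewrite [LHS]matrix_sum_delta pair_bigA.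
Qed.

(* The sum is m times the trace of the projection B |-> p (avg B) p. *)
Lemma sum_tr_idem_neq0 N (rho : A -> 'M[k]_N) p : representation rho ->
  intertwiner rho rho p -> p *m p = p -> p != 0 ->
  \sum_l \tr (p *m rho (f l)) * \tr (rho (q l) *m p) != 0.
Proof.
move=> r hp pp p0; pose F B := p *m avg rho rho B *m p.
have iF B : intertwiner rho rho (F B).
  move=> x xK; rewrite /F !mulmxA hp // -!mulmxA; congr (_ *m _).
  by rewrite mulmxA (avg_intertwiner r r) // -!mulmxA hp.
have Fl : lin F.
  apply: lin_mulmxl; apply: (@lin_mulmxr _ _ _ _ (avg rho rho)).
  apply: lin_scal; apply: lin_sum => l; apply: lin_mulmxl.
  by apply: (@lin_mulmxr _ _ _ _ (fun B => B)); exact: lin_id.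
have [|s [trF _ s0]] := tr_idem (mx_full_basis N) Fl.
  by move=> B; rewrite {1}/F (avg_fix r) // /F !mulmxA pp -!mulmxA pp.
apply: contraNneq p0 => h0; apply/eqP.
rewrite -[p](_ : F p = p); last by rewrite /F (avg_fix r) // !pp.
apply: s0; apply: (natr_inj_pchar0 ch); rewrite -trF /tr.
by rewrite -(pair_bigA _ (fun i j => F (delta_mx i j) i j)) /= sum_avg_delta h0 mulr0.
Qed.

Section Isomorphism.
Variables (N1 N2 : nat) (rho1 : A -> 'M[k]_N1) (rho2 : A -> 'M[k]_N2).
Hypotheses (r1 : representation rho1) (r2 : representation rho2).
Hypothesis tr12 : {in K, forall x, \tr (rho1 x) = \tr (rho2 x)}.

Lemma intertwiner_pinv B : intertwiner rho1 rho2 B ->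
  exists2 C, intertwiner rho2 rho1 C & B *m C *m B = B.
Proof.
move=> hB; exists (avg rho2 rho1 (pinvmx B)); first exact: avg_intertwiner.
by rewrite (avg_mul _ hB hB) mulmxKpV ?submx_refl // (avg_fix r1).
Qed.

Lemma intertwiner_extend B C : intertwiner rho1 rho2 B -> intertwiner rho2 rho1 C ->
  B *m C *m B = B -> B *m C != 1%:M ->
  exists2 B', intertwiner rho1 rho2 B' & (\rank B < \rank B')%N.
Proof.
move=> hB hC BCB BC1; pose p := 1%:M - B *m C; pose p' := 1%:M - C *m B.
have hp : intertwiner rho1 rho1 p.
  by move=> x xK; rewrite /p mulmxBr mulmxBl mulmx1 mul1mx mulmxA hB // -mulmxA hC // mulmxA.
have hp' : intertwiner rho2 rho2 p'.
  by move=> x xK; rewrite /p' mulmxBr mulmxBl mulmx1 mul1mx mulmxA hC // -mulmxA hB // mulmxA.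
have pB : p *m B = 0 by rewrite /p mulmxBl mul1mx BCB subrr.
have Bp' : B *m p' = 0 by rewrite /p' mulmxBr mulmx1 mulmxA BCB subrr.
have pp : p *m p = p by rewrite {2}/p mulmxBr mulmx1 mulmxA pB mul0mx subr0.
have p'p' : p' *m p' = p' by rewrite {1}/p' mulmxBl mul1mx -mulmxA Bp' mulmx0 subr0.
have p0 : p != 0 by rewrite subr_eq0 eq_sym.
have trp x : x \in K -> \tr (rho1 x *m p) = \tr (rho2 x *m p').
  move=> xK; rewrite /p /p' !mulmxBr !mulmx1 !raddfB /= tr12 //; congr (_ - _).
  by rewrite mulmxA hB // -mulmxA mxtrace_mulC mulmxA.
have [i [j ij]] : exists i j, p *m avg rho1 rho2 (delta_mx i j) *m p' != 0.
  apply: contrapT => nij; have := sum_tr_idem_neq0 r1 hp pp p0.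
  have := sum_avg_delta rho1 rho2 p p'; rewrite big1.
    move=> /esym/eqP; rewrite mulf_eq0 invr_eq0 (negPf m0) /= => /eqP h /negP; apply.
    by rewrite -[X in _ == X]h; apply/eqP; apply: eq_bigr => l _; rewrite trp.
  move=> i _; rewrite big1 // => j _; case: (eqVneq (p *m avg rho1 rho2 (delta_mx i j) *m p') 0).
    by move=> ->; rewrite mxE.
  by move=> h; case: nij; exists i, j.
set G := _ *m p' in ij.
have hG : intertwiner rho1 rho2 G.
  move=> x xK; rewrite /G !mulmxA hp // -!mulmxA; congr (_ *m _).
  by rewrite mulmxA (avg_intertwiner r1 r2) // -!mulmxA hp'.
have pG : p *m G = G by rewrite /G !mulmxA pp.
have Gp' : G *m p' = G by rewrite /G -mulmxA p'p'.
exists (B + G); first by move=> x xK; rewrite mulmxDr mulmxDl hB // hG.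
have sB : (B <= (B + G)%R)%MS.
  by apply/submxP; exists (1%:M - p); rewrite mulmxBl mul1mx mulmxDr pB pG add0r addrK.
have sG : (G <= (B + G)%R)%MS by apply/submxP; exists p; rewrite mulmxDr pB pG add0r.
have cap0 : (B :&: G)%MS = 0.
  have /submxP[E1 e1] := capmxSl B G; have /submxP[E2 e2] := capmxSr B G.
  have h1 : (B :&: G)%MS *m p' = 0 by rewrite e1 -mulmxA Bp' mulmx0.
  by rewrite e2 -Gp' mulmxA -e2.
have := mxrank_sum_cap B G; rewrite cap0 mxrank0 addn0 => rs.
have : (\rank (B + G)%MS <= \rank (B + G)%R)%N by apply: mxrankS; rewrite addsmx_sub sB sG.
rewrite rs; apply: leq_trans; rewrite -addn1 leq_add2l lt0n mxrank_eq0 //.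
Qed.

Lemma isomorphism_of_character : exists B C,
  [/\ intertwiner rho1 rho2 B, B *m C = 1%:M & C *m B = 1%:M].
Proof.
have ext s : (exists B C, [/\ intertwiner rho1 rho2 B, B *m C = 1%:M & C *m B = 1%:M]) \/
   exists2 B, intertwiner rho1 rho2 B & (s <= \rank B)%N.
  elim: s => [|s [IH|[B hB sB]]]; [|by left|].
    by right; exists 0 => // x xK; rewrite mulmx0 mul0mx.
  have [C hC BCB] := intertwiner_pinv hB.
  have [BC1|BC1] := eqVneq (B *m C) 1%:M; last first.
    have [B' hB' rB'] := intertwiner_extend hB hC BCB BC1.
    by right; exists B' => //; apply: leq_ltn_trans rB'.
  left; exists B, C; split=> //.
  apply/eqP; rewrite eq_sym -subr_eq0; apply/eqP; set p' := _ - _.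
  have p'p' : p' *m p' = p' by rewrite /p' mulmxBl mul1mx mulmxBr mulmx1 -mulmxA [B *m _]mulmxA BCB subrr subr0.
  have trp' : \tr p' = 0.
    rewrite /p' raddfB /= mxtrace_mulC BC1 !mxtrace1.
    have [_ _ e1] := r1; have [_ _ e2] := r2; have [K1 _ _] := sK.
    by have := tr12 K1; rewrite e1 e2 !mxtrace1 => ->; rewrite subrr.
  apply/eqP; rewrite -mxrank_eq0; apply/eqP/(natr_inj_pchar0 ch).
  by rewrite -mx_idem_trace.
have [//|[B _ rB]] := ext N1.+1.
by have := leq_trans rB (rank_leq_row B); rewrite ltnn.
Qed.

End Isomorphism.
End Intertwiners.

Section Freeness.
Variables (k : fieldType) (A : algType k) (t : A -> k) (n : nat) (X Y : 'I_n -> A).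
Variables (K : {pred A}) (m : nat) (f q : 'I_m -> A) (r : nat).
Hypotheses (ch : [pchar k] =i pred0) (m0 : (m%:R : k) != 0) (nE : n = (m * r)%N).
Hypotheses (tl : slin t) (sK : subalg_closed K).
Hypotheses (XY : dual_bases predT t X Y) (sumYX : \sum_l Y l * X l = n%:R).
Hypotheses (D : dual_bases K t f q) (sumfq : \sum_l f l * q l = m%:R).
Hypothesis sumqf : \sum_l q l * f l = m%:R.

Let ec := dual_bases_full tl XY.
Let fK l : f l \in K. Proof. by case: D => -[]. Qed.
Let D1 : {in K, forall a, \sum_l t (q l * a) *: f l = a}. Proof. by case: D. Qed.
Let K1 : 1 \in K. Proof. by case: sK. Qed.
Let KM : {in K &, forall a b, a * b \in K}. Proof. by case: sK. Qed.

Definition regular_mx (x : A) : 'M[k]_n := mxf X (fun l y => t (Y l * y)) (fun y => y * x).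

(* Right multiplication on K^r, in the basis (i, a) |-> f_a in the i-th component. *)
Definition free_mx (x : A) : 'M[k]_#|{: 'I_r * 'I_m}| := \matrix_(u, v)
  (((enum_val u).1 == (enum_val v).1)%:R * t (q (enum_val v).2 * (f (enum_val u).2 * x))).

Lemma regular_mx_rep : representation K regular_mx.
Proof.
split=> [|x y _ _|].
- by move=> c x y; apply/matrixP => i j; rewrite !mxE !mulrDr -!scalerAr tl.
- rewrite /regular_mx -(mxf_comp ec); [|by linp..].
  by apply/matrixP => i j; rewrite !mxE !mulrA.
- by rewrite -(mxf_id ec); apply/matrixP => i j; rewrite !mxE mulr1.
Qed.

Lemma free_mx_rep : representation K free_mx.
Proof.
split=> [|x y xK yK|].
- move=> c x y; apply/matrixP => i j; rewrite !mxE !mulrDr -!scalerAr tl mulrDr.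
  by rewrite mulrCA.
- apply/matrixP => u v; rewrite !mxE.
  rewrite (reindex _ (onW_bij _ (@enum_rank_bij {: 'I_r * 'I_m}))) /=.
  under eq_bigr do rewrite !mxE !enum_rankK.
  case: (enum_val u) (enum_val v) => [i a] [j b] /=.
  transitivity (\sum_i' \sum_a' (i == i')%:R * t (q a' * (f a * x)) *
    ((i' == j)%:R * t (q b * (f a' * y)))); last by rewrite pair_bigA.
  rewrite (bigD1 i) //= [X in _ + X]big1 ?addr0; last first.
    by move=> i' /negPf ii; rewrite big1 // => a' _; rewrite eq_sym ii !mul0r.
  have -> : f a * (x * y) = \sum_l t (q l * (f a * x)) *: (f l * y).
    rewrite mulrA -{1}(D1 (KM (fK a) xK)) mulr_suml.
    by apply: eq_bigr => l _; rewrite scalerAl.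
  rewrite mulr_sumr slin_sumE // mulr_sumr; apply: eq_bigr => l _.
  by rewrite eqxx mul1r -scalerAr slinZ // mulrCA.
apply/matrixP => u v; rewrite !mxE mulr1; have [_ _ _ ->] := D.
rewrite -natrM mulnb -val_eqE; congr ((_ : bool)%:R).
rewrite -(inj_eq enum_val_inj); case: (enum_val u) (enum_val v) => [i a] [j b] /=.
by rewrite xpair_eqE [b == a]eq_sym.
Qed.

Lemma tr_regular_free : {in K, forall x, \tr (free_mx x) = \tr (regular_mx x)}.
Proof.
move=> x xK; have natZ p : p%:R * x = p%:R *: x by rewrite mulr_natl scaler_nat.
have -> : \tr (regular_mx x) = n%:R * t x.
  rewrite /mxtrace; under eq_bigr do rewrite mxE mulrA.
  by rewrite -slin_sumE // -mulr_suml sumYX natZ slinZ.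
rewrite /mxtrace (reindex _ (onW_bij _ (@enum_rank_bij {: 'I_r * 'I_m}))) /=.
under eq_bigr do rewrite mxE enum_rankK eqxx mul1r mulrA.
transitivity (\sum_(i < r) \sum_a t (q a * f a * x)); first by rewrite pair_bigA.
rewrite -slin_sumE // -mulr_suml sumqf sumr_const card_ord.
by rewrite natZ slinZ // nE mulnC natrM -mulrA [RHS]mulr_natl.
Qed.

Lemma free_right_module : free_right_of_rank K r.
Proof.
have [B [C [hB BC CB]]] := isomorphism_of_character ch m0 sK D sumfq free_mx_rep
  regular_mx_rep tr_regular_free.
pose vec (v : 'rV_n) := \sum_l v 0 l *: X l.
have vecK v : rv (fun l y => t (Y l * y)) (vec v) = v.
  apply/rowP => l; rewrite mxE /vec mulr_sumr slin_sumE // (bigD1 l) //=.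
  have [_ _ _ D3] := XY; rewrite -scalerAr slinZ // D3 eqxx mulr1 big1 ?addr0 //.
  by move=> l' /negPf ll; rewrite -scalerAr slinZ // D3 eq_sym ll mulr0.
have rvK y : vec (rv (fun l y => t (Y l * y)) y) = y.
  by rewrite [RHS]ec.2; apply: eq_bigr => l _; rewrite mxE.
have vecM v x : vec (v *m regular_mx x) = vec v * x.
  by rewrite -{1}(vecK v) -(rv_mxf ec (f := fun y => y * x)) ?rvK //; linp.
have vec_sum I (F : I -> 'rV_n) (s : seq I) : vec (\sum_(i <- s) F i) = \sum_(i <- s) vec (F i).
  rewrite /vec exchange_big; apply: eq_bigr => l _ /=.
  by rewrite summxE scaler_suml.
pose one i : 'rV_#|{: 'I_r * 'I_m}| :=
  \row_u (((enum_val u).1 == i)%:R * t (q (enum_val u).2)).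
pose coords (b : {ffun 'I_r -> A}) : 'rV_#|{: 'I_r * 'I_m}| :=
  \row_u t (q (enum_val u).2 * b (enum_val u).1).
have coordsE (b : {ffun 'I_r -> A}) : (forall i, b i \in K) -> coords b = \sum_i one i *m free_mx (b i).
  move=> bK; apply/rowP => v; rewrite mxE summxE.
  under eq_bigr => i _.
    rewrite mxE (reindex _ (onW_bij _ (@enum_rank_bij {: 'I_r * 'I_m}))) /=.
    under eq_bigr do rewrite !mxE !enum_rankK.
    over.
  case: (enum_val v) => [j d] /=.
  transitivity (\sum_i \sum_i' \sum_a (i' == i)%:R * t (q a) *
      ((i' == j)%:R * t (q d * (f a * b i)))); last first.
    by apply: eq_bigr => i _; rewrite pair_bigA.
  rewrite (bigD1 j) //= [X in _ + X]big1 ?addr0; last first.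
    move=> i /negPf ij; rewrite big1 // => i' _; rewrite big1 // => a _.
    by case: eqVneq => [->|_]; rewrite ?ij ?mul0r ?mulr0.
  rewrite (bigD1 j) //= [X in _ + X]big1 ?addr0; last first.
    by move=> i' /negPf ij; rewrite big1 // => a _; rewrite ij !mul0r.
  rewrite -{1}[b j]mul1r -{1}(D1 K1) mulr_suml mulr_sumr slin_sumE //.
  by apply: eq_bigr => a _; rewrite eqxx !mul1r mulr1 -scalerAl -scalerAr slinZ.
pose E i := vec (one i *m B).
have EE (b : {ffun 'I_r -> A}) : (forall i, b i \in K) -> \sum_i E i * b i = vec (coords b *m B).
  move=> bK; rewrite coordsE // mulmx_suml vec_sum; apply: eq_bigr => i _.
  by rewrite -mulmxA hB // mulmxA vecM.
have sK' := subalg_subspace sK.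
exists E => a; pose v := rv (fun l y => t (Y l * y)) a *m C.
pose b : {ffun 'I_r -> A} := [ffun i => \sum_d v 0 (enum_rank (i, d)) *: f d].
have bK i : b i \in K by rewrite ffunE; apply: subspace_sum => // d _; apply: subspaceZ.
have bv : coords b = v.
  apply/rowP => u; rewrite mxE ffunE mulr_sumr slin_sumE // (bigD1 (enum_val u).2) //=.
  have [_ _ _ D3] := D; rewrite -scalerAr slinZ // D3 eqxx mulr1 big1 ?addr0.
    by rewrite -surjective_pairing enum_valK.
  by move=> d /negPf du; rewrite -scalerAr slinZ // D3 eq_sym du mulr0.
exists b; split; first by split=> //; rewrite EE // bv /v -mulmxA CB mulmx1 rvK.
move=> b' [b'K aE]; apply/ffunP => i.
have : coords b = coords b'.
  rewrite bv /v aE EE // vecK -mulmxA BC mulmx1 //.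
move=> /rowP bb; rewrite -(D1 (bK i)) -(D1 (b'K i)); apply: eq_bigr => l _.
by have := bb (enum_rank (i, l)); rewrite !mxE enum_rankK /= => ->.
Qed.

End Freeness.

(** * The Markov extension *)

Lemma centralizerP (k : fieldType) (A : algType k) (B : {pred A}) r :
  reflect {in B, forall b, r * b = b * r} (r \in centralizer B).
Proof. exact: asboolP. Qed.

Lemma centralizer_subalg (k : fieldType) (A : algType k) (B : {pred A}) :
  subalg_closed (centralizer B).
Proof.
split.
- by apply/centralizerP => b _; rewrite mulr1 mul1r.
- move=> c x y /centralizerP hx /centralizerP hy; apply/centralizerP => b bB.
  by rewrite mulrDl mulrDr -scalerAl -scalerAr hx // hy.
- move=> x y /centralizerP hx /centralizerP hy; apply/centralizerP => b bB.
  by rewrite -mulrA hy // mulrA hx // mulrA.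
Qed.

Section TracialPair.
Variables (k : closedFieldType) (A : algType k) (t : A -> k) (n : nat) (X Y : 'I_n -> A).
Variables (K : {pred A}) (m : nat) (f q : 'I_m -> A) (r : nat).
Hypotheses (ch : has_pchar0 k) (m0 : (m%:R : k) != 0) (n0 : (n%:R : k) != 0) (nE : n = (m * r)%N).
Hypotheses (tl : slin t) (tC : forall a b, t (a * b) = t (b * a)) (t1 : t 1 = 1).
Hypothesis sK : subalg_closed K.
Hypotheses (XY : dual_bases predT t X Y) (D : dual_bases K t f q).
Hypotheses (sumXY : \sum_l X l * Y l = n%:R) (sumYX : \sum_l Y l * X l = n%:R).
Hypotheses (sumfq : \sum_l f l * q l = m%:R) (sumqf : \sum_l q l * f l = m%:R).

Let fK l : f l \in K. Proof. by case: D => -[]. Qed.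
Let qK l : q l \in K. Proof. by case: D => -[]. Qed.
Let D1 : {in K, forall a, \sum_l t (q l * a) *: f l = a}. Proof. by case: D. Qed.
Let D2 : {in K, forall a, \sum_l t (a * f l) *: q l = a}. Proof. by case: D. Qed.
Let K1 : 1 \in K. Proof. by case: sK. Qed.
Let KM : {in K &, forall a b, a * b \in K}. Proof. by case: sK. Qed.
Let X1 a : \sum_l t (Y l * a) *: X l = a. Proof. by case: XY => _ + _ _; apply. Qed.
Let X2 a : \sum_l t (a * X l) *: Y l = a. Proof. by case: XY => _ _ + _; apply. Qed.
Let natZ p (x : A) : p%:R * x = p%:R *: x. Proof. by rewrite mulr_natl scaler_nat. Qed.
Local Notation R := (centralizer K).

Lemma trace_nondegenerate_full a : (forall b, t (a * b) = 0) -> a = 0.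
Proof. by move=> h; rewrite -[a]X2 big1 // => l _; rewrite h scale0r. Qed.

Lemma trace_nondegenerate_sub : {in K, forall a, {in K, forall b, t (a * b) = 0} -> a = 0}.
Proof. by move=> a aK h; rewrite -(D2 aK) big1 // => l _; rewrite h ?scale0r. Qed.

(* The t-orthogonal projection onto K. *)
Definition cond_exp a := \sum_l t (a * f l) *: q l.
Local Notation E := cond_exp.

Lemma cond_exp_linear : linear E.
Proof.
move=> c u v; rewrite /cond_exp scaler_sumr -big_split; apply: eq_bigr => l _.
by rewrite mulrDl -scalerAl tl scalerDl scalerA.
Qed.

Lemma cond_exp_in a : E a \in K.
Proof. by apply: subspace_sum => [|l _]; [|apply: subspaceZ]; try exact: subalg_subspace. Qed.

Lemma trace_cond_exp a b : b \in K -> t (E a * b) = t (a * b).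
Proof.
move=> bK; rewrite -{2}(D1 bK) mulr_suml mulr_sumr !slin_sumE //.
by apply: eq_bigr => l _; rewrite -scalerAl -scalerAr !slinZ // mulrC.
Qed.

Lemma cond_exp_unique a y : y \in K -> {in K, forall b, t (y * b) = t (a * b)} -> E a = y.
Proof.
move=> yK h; apply/eqP; rewrite -subr_eq0; apply/eqP; apply: trace_nondegenerate_sub.
  by apply: subspaceB; [exact: subalg_subspace | exact: cond_exp_in |].
by move=> b bK; rewrite mulrBl slinB // trace_cond_exp // h // subrr.
Qed.

Lemma cond_exp_bimodule a : {in K &, forall b b', E (b * a * b') = b * E a * b'}.
Proof.
move=> b b' bK b'K; apply: cond_exp_unique; first by rewrite !KM ?cond_exp_in.
move=> x xK; rewrite -!mulrA tC [RHS]tC -!mulrA.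
by rewrite trace_cond_exp // !KM.
Qed.

Lemma cond_exp1 : E 1 = 1.
Proof. exact: cond_exp_unique. Qed.

Lemma cond_exp_centralizer u a : u \in R -> E (u * a) = E (a * u).
Proof.
move/centralizerP => uR; apply: cond_exp_unique; first exact: cond_exp_in.
by move=> b bK; rewrite trace_cond_exp // -mulrA (uR b) // mulrA tC mulrA.
Qed.

Lemma cond_exp_frobenius a :
  \sum_l m%:R^-1 *: X l * E (Y l * a) = a /\ \sum_l E (a * (m%:R^-1 *: X l)) * Y l = a.
Proof.
split.
  transitivity (m%:R^-1 *: \sum_l a * f l * q l).
    rewrite scaler_sumr; transitivity (\sum_i \sum_l m%:R^-1 *: (t (Y i * (a * f l)) *: (X i * q l))).
      apply: eq_bigr => i _; rewrite -scalerAl -scaler_sumr mulr_sumr; congr (_ *: _).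
      by apply: eq_bigr => l _; rewrite -scalerAr mulrA.
    rewrite exchange_big; apply: eq_bigr => l _ /=.
    rewrite -scaler_sumr -{2}[a * f l]X1 mulr_suml; congr (_ *: _).
    by apply: eq_bigr => i _; rewrite scalerAl.
  under eq_bigr do rewrite -mulrA.
  by rewrite -mulr_sumr sumfq mulr_natr -scaler_nat scalerA mulVf ?scale1r.
transitivity (m%:R^-1 *: \sum_l q l * (f l * a)).
  rewrite scaler_sumr; transitivity (\sum_i \sum_l m%:R^-1 *: (t (f l * a * X i) *: (q l * Y i))).
    apply: eq_bigr => i _; rewrite -scaler_sumr mulr_suml scaler_sumr.
    apply: eq_bigr => l _; rewrite -scalerAr -!scalerAl slinZ // -scalerA.
    by rewrite [t (a * X i * f l)]tC mulrA.
  rewrite exchange_big; apply: eq_bigr => l _ /=.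
  rewrite -scaler_sumr -{2}[f l * a]X2 mulr_sumr; congr (_ *: _).
  by apply: eq_bigr => i _; rewrite scalerAr.
under eq_bigr do rewrite mulrA.
by rewrite -mulr_suml sumqf natZ scalerA mulVf ?scale1r.
Qed.

(* h |-> \sum_l f_l h q_l maps into the centralizer. *)
Lemma trace_nondegenerate_centralizer :
  {in R, forall a, {in R, forall b, t (a * b) = 0} -> a = 0}.
Proof.
move=> a /centralizerP aR h; apply: trace_nondegenerate_full => b.
have : t (a * \sum_l f l * b * q l) = 0.
  apply: h; apply/centralizerP => y yK; rewrite mulr_suml mulr_sumr.
  have e0 := dual_bases_casimir D (f := fun u v => u * b * v) (x := y) _ KM yK.
  transitivity (\sum_l f l * b * (q l * y)); first by apply: eq_bigr => l _; rewrite mulrA.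
  by rewrite -e0; [apply: eq_bigr => l _; rewrite !mulrA | linp].
rewrite mulr_sumr slin_sumE //.
under eq_bigr do rewrite mulrA tC !mulrA -[_ * a * _]mulrA aR // -!mulrA mulrA.
rewrite -slin_sumE // -mulr_suml sumqf natZ slinZ // => /eqP.
by rewrite mulf_eq0 (negPf m0) => /eqP.
Qed.

Lemma symmetric_markov_of_tracial_pair : symmetric_markov_extension K.
Proof.
split=> //; exists r; split.
  exact: (free_right_module ch m0 nE tl sK XY sumYX D sumfq sumqf).
pose EL : {linear A -> A} := HB.pack E (GRing.isLinear.Build k A A *:%R E cond_exp_linear).
exists EL, n, (fun l => m%:R^-1 *: X l), Y.
have rE : m%:R^-1 *: (n%:R : A) = r%:R.
  by rewrite nE natrM natZ scalerA mulVf ?scale1r.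
have sR := centralizer_subalg K.
have ntr B : trace_on B t by split=> [c x y _ _|x y _ _]; [apply: tl | apply: tC].
have tE a : t (E a) = t a by rewrite -[E a]mulr1 trace_cond_exp // mulr1.
split.
- by split; [split; [exact: cond_exp_in | exact: cond_exp_bimodule] | exact: cond_exp_frobenius].
- exact: cond_exp1.
- split.
    by under eq_bigr do rewrite -scalerAl; rewrite -scaler_sumr sumXY.
  by under eq_bigr do rewrite -scalerAr; rewrite -scaler_sumr sumYX.
- apply: (strongly_separable_of_trace ch n0 tl tC XY sumXY sR).
  exact: trace_nondegenerate_centralizer.
split; first by move=> u a uR; apply: cond_exp_centralizer.
exists t; have ntE B : trace_on B (t \o E).
  by split=> [c x y _ _|x y _ _] /=; rewrite !tE; [apply: tl | apply: tC].
split.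
- by [].
- by split=> //; exact: trace_nondegenerate_sub.
- by split=> //=; rewrite cond_exp1.
- split=> // a _ h; apply: trace_nondegenerate_full => b.
  by rewrite -tE; apply: h.
- split=> // a aR h; apply: trace_nondegenerate_centralizer => // b bR.
  by rewrite -tE; apply: h.
Qed.

End TracialPair.

Theorem theorem2p2 (k : closedFieldType) (char_k : has_pchar0 k)
    (H : hopfAlgType k) (ss_H : semisimple_algebra H)
    (K : {pred H}) (hopf_K : hopf_subalgebra K) :
  symmetric_markov_extension K /\ separable_algebra (centralizer K).
Proof.
suff mark : symmetric_markov_extension K.
  split=> //; case: mark => _ [r [_ [E [m [x [y [_ _ _ ss _]]]]]]].
  exact: separable_of_strongly_separable.
have [n0 [e [c [t [ec tI]]]]] := exists_normalized_integral char_k ss_H.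
have [tl tC t1 _] := tI.
have [n [X [Y [XY sumXY sumYX _]]]] := exists_sub_dual_bases ec tI (hopf_subalgebra_predT H).
have [m [f [q [D sumfq sumqf [L [LK LL tL]]]]]] := exists_sub_dual_bases ec tI hopf_K.
have nat0 p (g h : 'I_p -> H) : \sum_l g l * h l = p%:R -> p <> 0%N -> (p%:R : k) != 0.
  by have /pcharf0P -> := char_k => _ /eqP.
have n1 : (n%:R : k) != 0.
  apply: (nat0 _ _ _ sumXY) => n1; move: X Y XY {sumXY sumYX}; rewrite n1 => X Y [_ h _ _].
  by have /eqP := t1; rewrite -(h 1) // big_ord0 (slin0 tl) eq_sym oner_eq0.
have m1 : (m%:R : k) != 0.
  apply: (nat0 _ _ _ sumfq) => m1; move: f q D {sumfq sumqf LL}; rewrite m1 => f q [_ h _ _].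
  have /eqP := t1; rewrite -(h 1) ?(hopf_subalgebra1 hopf_K) // big_ord0 (slin0 tl).
  by rewrite eq_sym oner_eq0.
have fb := dual_bases_full tl XY.
have [||r [trr _ _]] := tr_idem (f := fun y => y * (m%:R^-1 *: L)) fb.
- by linp.
- move=> y; rewrite -mulrA; congr (_ * _).
  by rewrite -scalerAl -scalerAr LL !scalerA -mulrA mulVf // mulr1.
have nE : n = (m * r)%N.
  apply: (natr_inj_pchar0 char_k); rewrite natrM -trr /tr.
  under eq_bigr do rewrite mulrA; rewrite -slin_sumE // -mulr_suml sumYX.
  have -> : (n%:R : H) = n%:R *: 1 by rewrite scaler_nat.
  by rewrite -scalerAl mul1r !slinZ // tL mulr1 mulrCA mulfV // mulr1.
have [sK _ _] := hopf_K.
exact: (symmetric_markov_of_tracial_pair char_k m1 n1 nE tl tC t1 sK XY D sumXY sumYX sumfq sumqf).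
Qed.
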